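(* Let $\alpha$ be a peak composition of $n$. (a) $\mathrm{ch}(\mathbf{Q}^{\rm c}_\alpha)=\mathrm{ch}(\mathbf{Q}^{\rm r}_\alpha)$. (b) If $\alpha$ has at most one part greater than $2$, then $\mathbf{Q}^{\rm c}_\alpha=\mathbf{Q}^{\rm r}_\alpha$ as $H_n(0)$-modules. Otherwise, $\mathbf{Q}^{\rm c}_\alpha\not\cong\mathbf{Q}^{\rm r}_\alpha$ as $H_n(0)$-modules. (c) If $\alpha$ has at most one part greater than $2$, then there exists a descent-preserving colored digraph isomorphism between $\mathsf{RW}_{\rm c}(\alpha)$ and $\mathsf{RW}_{\rm r}(\alpha)$. Moreover, the intervals $[\gamma,\xi\gamma]_L$, for all $\gamma\in[\mathrm{w}_{\rm c}(T^{\rm sup}_\alpha),\mathrm{w}_{\rm r}(T^{\rm sup}_\alpha)]_R$, are equivalent to each other up to descent-preserving colored digraph isomorphism, where $\xi=\mathrm{w}_{\rm c}(T^{\rm source}_\alpha)\,\mathrm{w}_{\rm c}(T^{\rm sup}_\alpha)^{-1}$.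
   Context: A composition $\alpha=(\alpha_1,\dots,\alpha_k)$ of $n$ is a finite list of positive integers with sum $n$; $\ell(\alpha)=k$; $\mathrm{set}(\alpha)=\{\alpha_1,\alpha_1+\alpha_2,\dots,\alpha_1+\cdots+\alpha_{k-1}\}$. Its diagram $D(\alpha)$ is the left-justified array with $\alpha_i$ boxes in row $i$, rows numbered from bottom to top. A peak composition is a composition all of whose parts, except possibly the last, are greater than $1$. A standard immaculate tableau (SIT) of shape $\alpha$ is a filling of $D(\alpha)$ with $1,\dots,n$, each used once, whose rows increase from left to right and whose first column increases from bottom to top. For a peak composition $\alpha$, a standard peak immaculate tableau (SPIT) of shape $\alpha$ is an SIT of shape $\alpha$ such that for every $1\le k\le n$ the boxes with entries $\le k$ form the diagram of a peak composition; $\mathrm{SPIT}(\alpha)$ is the set of these. $s_i\cdot T$ is obtained from $T$ by swapping $i$ and $i+1$. $\mathrm{w}_{\rm c}(T)$: read entries column by column starting from the leftmost column, each column from bottom to top. $\mathrm{w}_{\rm r}(T)$: read entries row by row starting from the uppermost row, each row from left to right. Both are permutations in $\mathfrak{S}_n$ in one-line notation. $\mathsf{RW}_{\rm c}(\alpha)=\{\mathrm{w}_{\rm c}(T)\mid T\in\mathrm{SPIT}(\alpha)\}$ and $\mathsf{RW}_{\rm r}(\alpha)=\{\mathrm{w}_{\rm r}(T)\mid T\in\mathrm{SPIT}(\alpha)\}$. $\mathrm{Des}(\sigma)=\{i\in[n-1]\mid i$ is to the right of $i+1$ in $\sigma(1)\cdots\sigma(n)\}$. $T^{\rm source}_\alpha$: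 the SPIT of shape $\alpha$ filled with $1,2,\dots,n$ row by row, rows from bottom to top, each row from left to right. $T^{\rm sup}_\alpha$: the SPIT of shape $\alpha$ whose first column (bottom to top) consists of the first $\ell(\alpha)$ odd numbers, whose second column consists of the first $\ell(\alpha)$ even numbers (the first $\ell(\alpha)-1$ if the last part of $\alpha$ is $1$), and whose subsequent columns, from left to right, are filled with the remaining numbers, increasing consecutively up each column. Weak orders: the left weak Bruhat order $\preceq_L$ on $\mathfrak{S}_n$ is generated by the covers $\sigma\prec s_i\sigma$ for $i\notin\mathrm{Des}(\sigma)$ ($s_i=(i\ i+1)$, acting on values); the right weak Bruhat order $\preceq_R$ is generated by the covers $\sigma\prec\sigma s_i$ for $\sigma(i)<\sigma(i+1)$. $[\sigma,\rho]_L$ and $[\sigma,\rho]_R$ are the corresponding intervals. For left weak Bruhat intervals $I_1,I_2$ a bijection $f:I_1\to I_2$ is a colored digraph isomorphism if for all $\gamma,\gamma'\in I_1$ and $1\le i\le n-1$: $\gamma\overset{i}{\to}\gamma'$ iff $f(\gamma)\overset{i}{\to}f(\gamma')$, where $\gamma\overset{i}{\to}\gamma'$ means $\gamma\preceq_L\gamma'$ and $s_i\gamma=\gamma'$. It is descent-preserving if $\mathrm{Des}(f(\gamma))=\mathrm{Des}(\gamma)$ for all $\gamma$. (When $\alpha$ has at most one part greater than $2$, both $\mathsf{RW}_{\rm c}(\alpha)$ and $\mathsf{RW}_{\rm r}(\alpha)$ are left weak Bruhat intervals.) The $0$-Hecke algebra $H_n(0)$ is the associative unital $\mathbb{C}$-algebra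 generated by $\overline{\pi}_1,\dots,\overline{\pi}_{n-1}$ with $\overline{\pi}_i^2=-\overline{\pi}_i$, $\overline{\pi}_i\overline{\pi}_{i+1}\overline{\pi}_i=\overline{\pi}_{i+1}\overline{\pi}_i\overline{\pi}_{i+1}$, and $\overline{\pi}_i\overline{\pi}_j=\overline{\pi}_j\overline{\pi}_i$ for $|i-j|\ge2$. Its irreducible modules are the one-dimensional $\mathbf{F}_\beta=\mathbb{C}v_\beta$ ($\beta$ a composition of $n$) with $\overline{\pi}_iv_\beta=-v_\beta$ if $i\in\mathrm{set}(\beta)$ and $0$ otherwise. The quasisymmetric characteristic $\mathrm{ch}$ is the linear map from the Grothendieck group of finite-dimensional $H_n(0)$-modules to quasisymmetric functions sending $[\mathbf{F}_\beta]$ to the fundamental quasisymmetric function $F_\beta=\sum x_{i_1}\cdots x_{i_n}$ (sum over $1\le i_1\le\cdots\le i_n$ with $i_j<i_{j+1}$ if $j\in\mathrm{set}(\beta)$). $\mathbf{Q}^{\rm c}_\alpha$ and $\mathbf{Q}^{\rm r}_\alpha$ are the $H_n(0)$-modules with underlying space $\mathbb{C}\,\mathrm{SPIT}(\alpha)$ and actions, with $\mathrm{w}=\mathrm{w}_{\rm c}$ for $\mathbf{Q}^{\rm c}_\alpha$ and $\mathrm{w}=\mathrm{w}_{\rm r}$ for $\mathbf{Q}^{\rm r}_\alpha$: for $T\in\mathrm{SPIT}(\alpha)$, $\overline{\pi}_i$ sends $T$ to $-T$ if $i\in\mathrm{Des}(\mathrm{w}(T))$; to $0$ if $i\notin\mathrm{Des}(\mathrm{w}(T))$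 and $s_i\cdot T\notin\mathrm{SPIT}(\alpha)$; and to $s_i\cdot T$ if $i\notin\mathrm{Des}(\mathrm{w}(T))$ and $s_i\cdot T\in\mathrm{SPIT}(\alpha)$. *)

(* Defs.v *)
From HB Require Import structures.
From mathcomp Require Import all_boot all_order all_fingroup all_algebra.
From mathcomp Require Import finmap multiset complex.
From mathcomp Require Import boolp classical_sets fsbigop reals.

Set Implicit Arguments.
Unset Strict Implicit.
Unset Printing Implicit Defensive.

Import GRing.Theory.

Local Open Scope nat_scope.

(* Numbers, rows, columns and positions are ordinals, hence counted from 0:   *)
(* v : 'I_n stands for the number v.+1 of {1, ..., n}, and i : 'I_n.-1 stands *)
(* for the index i.+1 of [n-1] = {1, ..., n-1}; lo i and hi i are then the    *)
(* elements of 'I_n that stand for the numbers i.+1 and i.+2.                 *)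

Definition lo n (i : 'I_n.-1) : 'I_n := widen_ord (leq_pred n) i.

Lemma hi_subproof n (i : 'I_n.-1) : i.+1 < n.
Proof. by case: n i => [|n] [i /= hi] //. Qed.

Definition hi n (i : 'I_n.-1) : 'I_n := Ordinal (hi_subproof i).

Definition is_composition (a : seq nat) : bool := all (ltn 0) a.

Definition is_peak (a : seq nat) : bool :=
  is_composition a && all (ltn 1) (take (size a).-1 a).

Record peak_composition := PeakComposition {
  parts :> seq nat;
  parts_peak : is_peak parts }.

Definition partial_sums (b : seq nat) : seq nat :=
  [seq sumn (take j b) | j <- iota 1 (size b).-1].

Definition cset n (b : seq nat) : {set 'I_n.-1} :=
  [set i : 'I_n.-1 | i.+1 \in partial_sums b].

(* The box (i, j) lies in row i from the bottom and column j from the left.   *)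
Definition diagram (a : seq nat) : set (nat * nat) :=
  [set x | (x.1 < size a) && (x.2 < nth 0 a x.1)]%classic.

(* The boxes of diagram a, as a finite type.                                  *)
Notation box a := {i : 'I_(size a) & 'I_(nth 0 a i)}.

Definition row (a : seq nat) (b : box a) : nat := tag b.
Definition col (a : seq nat) (b : box a) : nat := tagged b.

Notation filling a := {ffun box a -> 'I_(sumn a)}.

Definition entry (a : seq nat) (T : filling a) (b : box a) : nat := (T b).+1.

Definition is_SIT (a : seq nat) (T : filling a) : Prop :=
  [/\ forall v, #|[set b | T b == v]| = 1,
      forall b b', row b = row b' -> col b < col b' -> entry T b < entry T b'
    & forall b b', col b = 0 -> col b' = 0 -> row b < row b' ->
        entry T b < entry T b'].

Definition boxes_le (a : seq nat) (T : filling a) (k : nat) : set (nat * nat) :=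
  [set x | exists2 b, entry T b <= k & x = (row b, col b)]%classic.

Definition is_SPIT (a : seq nat) (T : filling a) : Prop :=
  is_SIT T /\
  forall k, 1 <= k <= sumn a ->
    exists2 b, is_peak b & boxes_le T k = diagram b.

Notation SPIT a := {T : filling a | `[< is_SPIT T >]}.

Lemma card_box (a : seq nat) : #|{: box a}| = sumn a.
Proof.
rewrite card_tagged; congr sumn; apply: (@eq_from_nth _ 0).
  by rewrite size_map -cardE card_ord.
move=> k; rewrite size_map -cardE card_ord => hk.
rewrite (nth_map (Ordinal hk)) ?size_enum_ord // card_ord.
by rewrite nth_enum_ord.
Qed.

(* The filling with entries e b, for e with values in {1, ..., sumn a};       *)
(* insubd falls back on an arbitrary entry out of this range.                 *)
Definition fill (a : seq nat) (e : box a -> nat) : filling a :=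
  [ffun b => insubd (cast_ord (card_box a) (enum_rank b)) (e b).-1].

Lemma fillE (a : seq nat) (e : box a -> nat) b :
  0 < e b <= sumn a -> entry (fill e) b = e b.
Proof.
case/andP=> e0 en; rewrite /entry ffunE val_insubd prednK // en.
by rewrite prednK.
Qed.

Definition Tsource (a : seq nat) : filling a :=
  fill (fun b => (sumn (take (row b) a) + col b).+1).

(* The order in which boxes are read by w_c, and by w_r.                      *)
Definition col_order (a : seq nat) : rel (box a) :=
  fun b b' => (col b < col b') || ((col b == col b') && (row b <= row b')).

Definition row_order (a : seq nat) : rel (box a) :=
  fun b b' => (row b' < row b) || ((row b == row b') && (col b <= col b')).

(* The first two columns use up the numbers 1, ..., m where m is their number *)
(* of boxes, so a box b further to the right receives m plus the rank of b,   *)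
(* in the column reading order, among the boxes outside these two columns.    *)
Definition Tsup (a : seq nat) : filling a :=
  fill (fun b =>
    if col b == 0 then (row b).*2.+1
    else if col b == 1 then (row b).*2.+2
    else #|[set b' : box a | col b' < 2]| +
         #|[set b' : box a | (2 <= col b') && col_order b' b]|).

(* In MathComp (s * t)%g is the permutation x |-> t (s x).                    *)
Definition perm_comp n (s t : 'S_n) : 'S_n := (t * s)%g.

Definition sperm n (i : 'I_n.-1) : 'S_n := tperm (lo i) (hi i).

Definition Des n (s : 'S_n) : {set 'I_n.-1} :=
  [set i | (s^-1)%g (hi i) < (s^-1)%g (lo i)].

Definition of_one_line n (w : seq 'I_n) : 'S_n :=
  odflt 1%g [pick s : 'S_n | [seq s p | p : 'I_n] == w].

Definition reading (a : seq nat) (r : rel (box a)) (T : filling a) :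
    'S_(sumn a) :=
  of_one_line [seq T b | b <- sort r (enum {: box a})].

Definition w_c (a : seq nat) : filling a -> 'S_(sumn a) :=
  reading (@col_order a).
Definition w_r (a : seq nat) : filling a -> 'S_(sumn a) :=
  reading (@row_order a).

Definition RW_c (a : peak_composition) : {set 'S_(sumn a)} :=
  [set w_c (val T) | T : SPIT a].
Definition RW_r (a : peak_composition) : {set 'S_(sumn a)} :=
  [set w_r (val T) | T : SPIT a].

Definition cover_L n : rel 'S_n := fun s t =>
  [exists i : 'I_n.-1, (i \notin Des s) && (t == perm_comp (sperm i) s)].

Definition cover_R n : rel 'S_n := fun s t =>
  [exists i : 'I_n.-1, (s (lo i) < s (hi i)) && (t == perm_comp s (sperm i))].

Definition le_L n : rel 'S_n := connect (@cover_L n).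
Definition le_R n : rel 'S_n := connect (@cover_R n).

Definition int_L n (s t : 'S_n) : {set 'S_n} := [set g | le_L s g && le_L g t].
Definition int_R n (s t : 'S_n) : {set 'S_n} := [set g | le_R s g && le_R g t].

Definition arrow n (i : 'I_n.-1) : rel 'S_n :=
  fun g g' => le_L g g' && (perm_comp (sperm i) g == g').

Definition colored_digraph_iso n (I1 I2 : {set 'S_n}) (f : 'S_n -> 'S_n) :
    Prop :=
  [/\ {in I1 &, injective f}, [set f g | g in I1] = I2
    & {in I1 &, forall g g', forall i, arrow i g g' = arrow i (f g) (f g')}].

Definition descent_preserving n (I1 : {set 'S_n}) (f : 'S_n -> 'S_n) : Prop :=
  {in I1, forall g, Des (f g) = Des g}.

Definition dp_isomorphic n (I1 I2 : {set 'S_n}) : Prop :=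
  exists2 f, colored_digraph_iso I1 I2 f & descent_preserving I1 f.

(* The tableau s_i . T.                                                       *)
Definition sact (a : seq nat) (i : 'I_(sumn a).-1) (T : filling a) :
    filling a :=
  [ffun b => sperm i (T b)].

(* For bijective T, membership in SPIT(a) means that T increases along cov.   *)
Definition cov (a : seq nat) : rel (box a) := fun b b' =>
  ((row b == row b') && (col b < col b')) ||
  ((row b < row b') && (col b <= 1)).

Lemma cov_trans (a : seq nat) : transitive (@cov a).
Proof.
move=> y x z; rewrite /cov.
case/orP=> /andP[]; [move/eqP=> -> xy | move=> xy cx].
  case/orP=> /andP[-> yz] /=; first by rewrite (ltn_trans xy yz).
  by rewrite (leq_trans (ltnW xy) yz) orbT.
case/orP=> /andP[]; first by move/eqP=> <- _; rewrite xy cx orbT.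
by move=> yz _; rewrite (ltn_trans xy yz) cx orbT.
Qed.

Lemma box_eq (a : seq nat) (b b' : box a) :
  row b = row b' -> col b = col b' -> b = b'.
Proof.
case: b b' => [i j] [i' j']; rewrite /row /col /= => /val_inj ii'.
by case: i' / ii' j' => j' /val_inj ->.
Qed.

Lemma count_down (p : pred nat) N :
  (forall j j', j <= j' -> p j' -> p j) -> (forall j, p j -> j < N) ->
  forall j, (j < count p (iota 0 N)) = p j.
Proof.
elim: N p => [|N IH] p pd pN j; first by apply/esym/negP=> /pN.
rewrite -(addn1 N) iotaD count_cat /= !add0n addn0.
case pNE: (p N); last first.
  rewrite addn0 IH // => j' pj'; have := pN _ pj'; rewrite ltnS leq_eqVlt.
  by case/predU1P=> // jN; rewrite jN pNE in pj'.
have -> : count p (iota 0 N) = N.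
  rewrite -[RHS](size_iota 0 N); apply/eqP; rewrite -all_count.
  by apply/allP=> x; rewrite mem_iota /= add0n => /ltnW/pd; apply.
rewrite addn1; apply/idP/idP=> [|/pN //].
by rewrite ltnS => /pd; apply.
Qed.

Lemma SPITP (a : peak_composition) (T : filling a) :
  is_SPIT T <-> injective T /\ forall b b', cov b b' -> T b < T b'.
Proof.
have /andP[_ apk] := parts_peak a.
split=> [[[T1 Trow _] Tk]|[Tinj Tcov]].
  have Tinj : injective T.
    move=> b b' bb'; have /eqP/cards1P[x Sx] := T1 (T b').
    have : b \in [set x] by rewrite -Sx inE bb'.
    have : b' \in [set x] by rewrite -Sx inE.
    by rewrite !inE => /eqP-> /eqP.
  split=> // b b' /orP[/andP[/eqP hr hc]|/andP[hr hc]].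
    by have := Trow _ _ hr hc; rewrite /entry ltnS.
  have hk : 1 <= entry T b' <= sumn a by rewrite /entry /= ltn_ord.
  have [be /andP[_ bpk] eqbe] := Tk _ hk.
  have : diagram be (row b', col b') by rewrite -eqbe; exists b'.
  rewrite /diagram /= => /andP[hs _].
  have hr' : row b < (size be).-1.
    by case: (size be) hs => // s; apply: leq_trans hr.
  have : diagram be (row b, col b).
    rewrite /diagram /= (ltn_trans hr hs) /=; apply: leq_ltn_trans hc _.
    rewrite -(nth_take _ hr'); apply: (allP bpk); apply: mem_nth.
    by rewrite size_take_min leq_min hr' (ltn_trans hr hs).
  rewrite -eqbe => -[b0 le0 [r0 c0]].
  rewrite -(box_eq r0 c0) /entry ltnS leq_eqVlt in le0.
  case/predU1P: le0 => [/val_inj/Tinj eqb|//].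
  by rewrite eqb ltnn in hr.
have Tbij v : #|[set b | T b == v]| = 1.
  have : v \in codom T by apply: inj_card_onto => //; rewrite card_box card_ord.
  case/codomP=> b ->; apply/eqP/cards1P; exists b.
  by apply/finset.setP=> b'; rewrite !inE (inj_eq Tinj).
have cmono b b' : cov b b' -> entry T b < entry T b'.
  by move/Tcov; rewrite /entry ltnS.
split.
  split=> // [b b' hr hc|b b' c0 c0' hr]; apply: cmono; rewrite /cov.
    by rewrite hr eqxx hc.
  by rewrite hr c0 orbT.
move=> k _.
pose X (i j : nat) : bool :=
  [exists b : box a, [&& row b == i, col b == j & entry T b <= k]].
have XP i j : reflect
    (exists2 b : box a, entry T b <= k & (i, j) = (row b, col b)) (X i j).
  apply: (iffP existsP) => [[b /and3P[/eqP<- /eqP<- hb]]|[b hb [-> ->]]].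
    by exists b.
  by exists b; rewrite !eqxx.
have mkbox i j : i < size a -> j < nth 0 a i ->
    exists b : box a, row b = i /\ col b = j.
  move=> hi hj; exists (existT (fun i : 'I_(size a) => 'I_(nth 0 a i))
    (Ordinal hi) (Ordinal (hj : j < nth 0 a (Ordinal hi)))).
  by [].
have Xcol i j j' : j <= j' -> X i j' -> X i j.
  rewrite leq_eqVlt => /predU1P[-> //|jj'] /XP[b hb [ri cj]].
  have [||b' [rb' cb']] := mkbox i j.
  - by rewrite ri /row ltn_ord.
  - by apply: ltn_trans jj' _; rewrite ri cj /row /col ltn_ord.
  apply/XP; exists b'; rewrite ?rb' ?cb' //.
  by apply: leq_trans hb; apply/ltnW/cmono;
    rewrite /cov rb' cb' ri -cj eqxx jj'.
have Xrow i i' j' : i < i' -> X i' j' -> X i 1.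
  move=> ii' /XP[b hb [ri cj]].
  have ri' : i' < size a by rewrite ri /row ltn_ord.
  have hi : i < (size a).-1 by case: (size a) ri' => // s; apply: leq_trans ii'.
  have [||b' [rb' cb']] := mkbox i 1.
  - exact: ltn_trans ri'.
  - rewrite -(nth_take _ hi); apply: (allP apk); apply: mem_nth.
    by rewrite size_take_min leq_min hi (ltn_trans ii' ri').
  apply/XP; exists b'; rewrite ?rb' ?cb' //.
  by apply: leq_trans hb; apply/ltnW/cmono; rewrite /cov rb' cb' -ri ii' orbT.
have Xr0 i i' : i <= i' -> X i' 0 -> X i 0.
  rewrite leq_eqVlt => /predU1P[-> //|ii'] /(Xrow _ _ _ ii').
  exact: Xcol.
have Xbr i j : X i j -> i < size a.
  by case/XP=> b _ [-> _]; rewrite /row ltn_ord.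
have Xbc i j : X i j -> j < sumn a.
  case/XP=> b _ [_ ->]; apply: leq_trans (ltn_ord (tagged b)) _.
  rewrite sumnE (big_nth 0) big_mkord (bigD1 (tag b)) //=.
  exact: leq_addr.
pose m := count (X^~ 0) (iota 0 (size a)).
pose be := mkseq (fun i => count (X i) (iota 0 (sumn a))) m.
have mE i : (i < m) = X i 0.
  by rewrite /m count_down //= => j; apply: Xbr.
have beE i j : (j < count (X i) (iota 0 (sumn a))) = X i j.
  by rewrite count_down // => [j1 j2|j1]; [apply: Xcol|apply: Xbc].
exists be.
  apply/andP; split.
    apply/(all_nthP 0) => i; rewrite size_mkseq => hi.
    by rewrite nth_mkseq //= beE -mE.
  apply/(all_nthP 0) => i; rewrite size_take_min leq_min size_mkseq.
  case/andP=> hi1 hi2; rewrite nth_take // nth_mkseq //= beE.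
  have : X i.+1 0 by rewrite -mE; case: (m) hi1.
  exact: Xrow.
apply/seteqP; split=> -[i j]; rewrite /boxes_le /diagram /=.
  move/XP=> h; rewrite size_mkseq.
  have h0 : X i 0 by apply: Xcol h.
  by rewrite mE h0 nth_mkseq ?mE //= beE.
rewrite size_mkseq => /andP[hi]; rewrite nth_mkseq // beE.
by move/XP.
Qed.

Definition pos (a : seq nat) (r : rel (box a)) (b : box a) : nat :=
  index b (sort r (enum {: box a})).

Lemma pos_inj (a : seq nat) (r : rel (box a)) : injective (pos r).
Proof.
move=> b b' /(congr1 (nth b (sort r (enum {: box a})))).
by rewrite !nth_index // mem_sort mem_enum.
Qed.

Lemma size_sort_box (a : seq nat) (r : rel (box a)) :
  size (sort r (enum {: box a})) = sumn a.
Proof. by rewrite size_sort -cardE card_box. Qed.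

Lemma pos_ltn (a : seq nat) (r : rel (box a)) b : pos r b < sumn a.
Proof. by rewrite -(size_sort_box r) index_mem mem_sort mem_enum. Qed.

Lemma readingE (a : seq nat) (r : rel (box a)) (T : filling a) b :
  injective T -> reading r T (Ordinal (pos_ltn r b)) = T b.
Proof.
move=> Tinj; rewrite /reading /of_one_line.
set w := [seq T b | b <- _].
have sw : size w = sumn a by rewrite size_map size_sort_box.
have uw : uniq w by rewrite map_inj_uniq // sort_uniq enum_uniq.
have tinj : injective (tnth (Tuple (introT eqP sw))).
  by apply/tuple_uniqP.
case: pickP => /= [s /eqP sE | /(_ (perm tinj))].
  have -> : s (Ordinal (pos_ltn r b)) = nth (T b) w (pos r b).
    rewrite -sE (nth_map (Ordinal (pos_ltn r b))) ?size_enum_ord ?pos_ltn //.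
    by congr (s _); apply: val_inj; rewrite /= nth_enum_ord ?pos_ltn.
  rewrite (nth_map b) ?size_sort_box ?pos_ltn // nth_index //.
  by rewrite mem_sort mem_enum.
case/eqP; rewrite /image_mem (eq_map (permE tinj)).
by rewrite map_tnth_enum.
Qed.

Lemma DesE (a : seq nat) (r : rel (box a)) (T : filling a) i c d :
  injective T -> T c = lo i -> T d = hi i ->
  (i \in Des (reading r T)) = (pos r d < pos r c).
Proof.
move=> Tinj Tc Td; rewrite inE -Tc -Td.
by rewrite -!(readingE r _ Tinj) !permK.
Qed.

Lemma lo_hi n (i : 'I_n.-1) : lo i != hi i.
Proof. by rewrite -(inj_eq val_inj) /= neq_ltn ltnSn. Qed.

Lemma swap_inj (a : seq nat) i (T : filling a) :
  injective T -> injective (sact i T).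
Proof. by move=> Tinj b b'; rewrite !ffunE => /perm_inj/Tinj. Qed.

Lemma cell (a : peak_composition) (T : filling a) v :
  is_SPIT T -> exists b, T b = v.
Proof.
move/SPITP=> [Tinj _].
have : v \in codom T by apply: inj_card_onto => //; rewrite card_box card_ord.
by case/codomP=> b ->; exists b.
Qed.

Lemma swap_SPIT (a : peak_composition) (T : filling a) i c d :
  is_SPIT T -> T c = lo i -> T d = hi i ->
  is_SPIT (sact i T) <-> ~~ cov c d.
Proof.
move=> /SPITP[Tinj Tcov] Tc Td; split=> [/SPITP[_ Scov]|ncd].
  apply/negP=> /Scov; rewrite !ffunE Tc Td /sperm tpermL tpermR /=.
  by rewrite ltnNge leqnSn.
apply/SPITP; split=> [|b b' bb']; first exact: swap_inj.
have := Tcov _ _ bb'; rewrite !ffunE /sperm.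
have [bc|bc] := eqVneq b c; have [bd|bd] := eqVneq b' d.
- by rewrite bc bd (negPf ncd) in bb'.
- rewrite bc Tc tpermL; have b'd : T b' != hi i by rewrite -Td (inj_eq Tinj).
  case: tpermP => [->|E|_ _]; rewrite ?ltnn //; first by rewrite E eqxx in b'd.
  rewrite /= => h; rewrite ltn_neqAle h andbT eq_sym; exact: b'd.
- rewrite bd Td tpermR; have bc' : T b != lo i by rewrite -Tc (inj_eq Tinj).
  case: tpermP => [E|->|_ _]; rewrite ?ltnn //; first by rewrite E eqxx in bc'.
  rewrite /= ltnS => h; rewrite ltn_neqAle h andbT; exact: bc'.
- have Tb : T b != lo i by rewrite -Tc (inj_eq Tinj).
  have Tb' : T b' != hi i by rewrite -Td (inj_eq Tinj).
  case: tpermP => [E|E|_ _]; first by rewrite E eqxx in Tb.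
    case: tpermP => [->|E'|_ _]; last 2 first.
    - by rewrite E' eqxx in Tb'.
    - by rewrite E /=; apply: ltn_trans.
    by rewrite E /= ltnNge leqnSn.
  case: tpermP => [->|E'|_ _] //=; last by rewrite E' eqxx in Tb'.
  by move=> h; apply: ltn_trans h _.
Qed.

Local Open Scope ring_scope.

Definition hecke_relations (K : fieldType) n (V : vectType K)
    (p : 'I_n.-1 -> 'End(V)) : Prop :=
  [/\ forall i, (p i \o p i)%VF = - p i,
      forall i j : 'I_n.-1, j = i.+1 :> nat ->
        (p i \o p j \o p i)%VF = (p j \o p i \o p j)%VF
    & forall i j : 'I_n.-1, (i.+1 < j)%N -> (p i \o p j)%VF = (p j \o p i)%VF].

(* H_n(0) being given by generators and relations, an H_n(0)-module is a      *)
(* vector space with endomorphisms that satisfy these relations.              *)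
Record hecke_module (K : fieldType) (n : nat) := HeckeModule {
  hm_space :> vectType K;
  hm_pi : 'I_n.-1 -> 'End(hm_space);
  hm_rel : hecke_relations hm_pi }.

Definition hecke_hom (K : fieldType) n (M N : hecke_module K n)
    (f : 'Hom(M, N)) : Prop :=
  forall i, (f \o hm_pi M i)%VF = (hm_pi N i \o f)%VF.

Definition hecke_iso (K : fieldType) n (M N : hecke_module K n) : Prop :=
  exists2 f : 'Hom(M, N), hecke_hom f & bijective f.

Definition short_exact (K : fieldType) n (M N P : hecke_module K n)
    (f : 'Hom(M, N)) (g : 'Hom(N, P)) : Prop :=
  [/\ hecke_hom f, hecke_hom g, lker f = 0%VS, limg f = lker g
    & limg g = fullv].

Definition irr_pi (K : fieldType) n (D : {set 'I_n.-1}) (i : 'I_n.-1) :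
    'End(K^o) :=
  (if i \in D then -1 else 0) *: \1%VF.

Lemma irr_pi_rel (K : fieldType) n (D : {set 'I_n.-1}) :
  hecke_relations (irr_pi K D).
Proof.
have E i v : irr_pi K D i v = (if i \in D then -1 else 0) *: v.
  by rewrite /irr_pi scale_lfunE id_lfunE.
split=> [i|i j _|i j _]; apply/lfunP=> v; rewrite !comp_lfunE ?opp_lfunE !E;
  by do ![case: ifP => _]; rewrite ?scaleN1r ?scale0r ?oppr0 ?scaler0 ?oppr0.
Qed.

Definition irr_module (K : fieldType) n (b : seq nat) : hecke_module K n :=
  HeckeModule (irr_pi_rel K (cset n b)).

(* A formal power series in x_0, x_1, ... is given by its coefficients, where *)
(* a multiset of indices stands for the product of the corresponding x's.     *)
Notation power_series K := ({mset nat}%mset -> K).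

Definition fundamental (K : fieldType) n (D : {set 'I_n.-1}) :
    power_series K := fun m =>
  \sum_(s \in [set s : n.-tuple nat | sorted leq s /\
       forall i, i \in D -> (tnth s (lo i) < tnth s (hi i))%N]%classic)
    ((seq_mset s == m)%:R : K).

(* Additive maps on the Grothendieck group are the functions on modules that  *)
(* are additive on short exact sequences.                                     *)
Definition is_ch (K : fieldType) n (ch : hecke_module K n -> power_series K) :
    Prop :=
  (forall (M N P : hecke_module K n) (f : 'Hom(M, N)) (g : 'Hom(N, P)),
     short_exact f g -> ch N = fun m => ch M m + ch P m) /\
  (forall b, is_composition b -> sumn b = n ->
     ch (irr_module K n b) = fundamental K (cset n b)).

Definition ltrace (K : fieldType) (V : vectType K) (f : 'End(V)) : K :=
  \tr (passmx.mxof (vbasis fullv) (vbasis fullv) f).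

Lemma ltraceC (K : fieldType) (V W : vectType K) (f : 'Hom(V, W))
    (g : 'Hom(W, V)) : ltrace (g \o f)%VF = ltrace (f \o g)%VF.
Proof.
by rewrite /ltrace !(passmx.mxof_comp _ _ (vbasisP _)) mxtrace_mulC.
Qed.

Lemma ltraceD (K : fieldType) (V : vectType K) (f g : 'End(V)) :
  ltrace (f + g) = ltrace f + ltrace g.
Proof.
by rewrite /ltrace -{1}[f]scale1r passmx.mxof_linear scale1r mxtraceD.
Qed.

Lemma ltrace_scalar (K : fieldType) (c : K) :
  ltrace (c *: \1%VF : 'End(K^o)) = c.
Proof.
set e := vbasis (fullv : {vspace K^o}).
have mxof0 : passmx.mxof e e 0 = 0.
  have := passmx.mxof_linear e e 1 0 0.
  rewrite !scale1r addr0 -[X in X = _]addr0.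
  by move/addrI.
rewrite /ltrace -[c *: _]addr0 passmx.mxof_linear mxof0 addr0 mxtraceZ.
rewrite passmx.mxof1 ?(basis_free (vbasisP _)) //.
by rewrite mxtrace1 dimvf /= mulr1.
Qed.

Lemma ltrace_short_exact (K : fieldType) n (M N P : hecke_module K n)
    (f : 'Hom(M, N)) (g : 'Hom(N, P)) x y z :
  short_exact f g -> (f \o x = y \o f)%VF -> (g \o y = z \o g)%VF ->
  ltrace y = ltrace x + ltrace z.
Proof.
case=> _ _ /eqP kf fg gf fx gy.
have f1 u : (f^-1)%VF (f u) = u by apply: lker0_lfunK.
have g1 u : g ((g^-1)%VF u) = u by apply: limg_lfunVK; rewrite gf memvf.
pose r := (f^-1 \o (\1 - (g^-1 \o g)))%VF.
have decomp v : v = f (r v) + (g^-1)%VF (g v).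
  rewrite /r comp_lfunE limg_lfunVK; last first.
    by rewrite fg memv_ker !lfunE /= !lfunE /= linearB /= comp_lfunE g1 subrr.
  by rewrite !lfunE /= !lfunE /= comp_lfunE subrK.
have fxE v : f (x v) = y (f v) by rewrite -!comp_lfunE fx.
have gyE v : g (y v) = z (g v) by rewrite -!comp_lfunE gy.
have rf v : r (f v) = v.
  have gfv : g (f v) = 0.
    by apply/eqP; rewrite -memv_ker -fg memv_img ?memvf.
  by rewrite /r comp_lfunE !lfunE /= !lfunE /= comp_lfunE gfv linear0 subr0.
clearbody r.
have -> : ltrace x = ltrace ((y \o f) \o r)%VF.
  rewrite ltraceC; congr ltrace; apply/lfunP => v.
  by rewrite !comp_lfunE -fxE rf.
have -> : ltrace z = ltrace ((y \o (g^-1)) \o g)%VF.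
  rewrite ltraceC; congr ltrace; apply/lfunP => v.
  by rewrite !comp_lfunE gyE g1.
rewrite -ltraceD; congr ltrace; apply/lfunP => v.
by rewrite add_lfunE !comp_lfunE -linearD -decomp.
Qed.

(* On irr_module b this is the identity if cset b is D, and 0 otherwise.      *)
Definition irr_projector (K : fieldType) n (M : hecke_module K n)
    (D : {set 'I_n.-1}) : 'End(M) :=
  \big[@comp_lfun _ _ _ _ / \1%VF]_(i : 'I_n.-1)
     (if i \in D then - hm_pi M i else \1%VF + hm_pi M i).

Lemma irr_projector_hom (K : fieldType) n (M N : hecke_module K n)
    (f : 'Hom(M, N)) D :
  hecke_hom f -> (f \o irr_projector M D = irr_projector N D \o f)%VF.
Proof.
move=> hf; rewrite /irr_projector.
apply: (big_ind2 (fun x y => f \o x = y \o f)%VF).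
- by rewrite comp_lfun1l comp_lfun1r.
- by move=> x x' y y' hx hy; rewrite comp_lfunA hx -comp_lfunA hy comp_lfunA.
move=> i _; case: ifP => _.
  by rewrite comp_lfunNl comp_lfunNr hf.
by rewrite comp_lfunDl comp_lfunDr hf comp_lfun1l comp_lfun1r.
Qed.

Lemma irr_projectorE (K : fieldType) n b (D : {set 'I_n.-1}) :
  irr_projector (irr_module K n b) D = (cset n b == D)%:R *: \1%VF.
Proof.
have -> : (cset n b == D) =
    \big[andb/true]_(i : 'I_n.-1) ((i \in cset n b) == (i \in D)).
  rewrite big_andE.
  apply/eqP/forallP=> [-> i|h]; first by rewrite eqxx.
  by apply/finset.setP => i; apply/eqP/h.
rewrite /irr_projector; transitivity
  (\big[@comp_lfun _ _ _ _ / \1%VF]_(i : 'I_n.-1)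
     (((i \in cset n b) == (i \in D))%:R *: \1%VF : 'End(K^o))).
  apply: eq_bigr => i _; apply/lfunP => v; rewrite /= /irr_pi.
  case: (i \in cset n b); case: (i \in D);
    by rewrite ?(opp_lfunE, add_lfunE, scale_lfunE, id_lfunE) /=
      ?scaleN1r ?opprK ?scale1r ?scale0r ?oppr0 ?subrr ?addr0.
apply: (big_ind2 (fun x (y : bool) => x = y%:R *: \1%VF :> 'End(K^o))) => //.
- by rewrite scale1r.
- move=> x x' y y' -> ->; apply/lfunP => v.
  rewrite comp_lfunE !scale_lfunE !id_lfunE /= scalerA.
  by case: x'; case: y'; rewrite ?mulr0 ?mulr1 ?mul0r.
Qed.

Lemma ch_exists (K : fieldType) n :
  exists ch : hecke_module K n -> power_series K, is_ch ch.
Proof.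
exists (fun M m => \sum_(D : {set 'I_n.-1})
           ltrace (irr_projector M D) * fundamental K D m); split.
  move=> M N P f g fg; apply: functional_extensionality_dep => m.
  rewrite -big_split /=; apply: eq_bigr => D _; rewrite -mulrDl; congr (_ * _).
  case: (fg) => hf hg _ _ _.
  by apply: ltrace_short_exact fg _ _; apply: irr_projector_hom.
move=> b _ _; apply: functional_extensionality_dep => m.
rewrite (bigD1 (cset n b)) //= irr_projectorE eqxx ltrace_scalar mul1r.
rewrite big1 ?addr0 // => D hD.
by rewrite irr_projectorE eq_sym (negPf hD) ltrace_scalar mul0r.
Qed.

Definition ch (K : fieldType) n : hecke_module K n -> power_series K :=
  sval (cid (ch_exists K n)).

Lemma chP (K : fieldType) n : is_ch (@ch K n).
Proof. exact: svalP (cid (ch_exists K n)). Qed.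

Lemma braid_cases (V : zmodType) (f g : V -> V) (v v1 v2 v12 v21 w : V)
    (dxy dyz dxz cxy cyz cxz : bool) :
  f 0 = 0 -> g 0 = 0 ->
  {morph f : x / - x} -> {morph g : x / - x} ->
  (dxy -> dyz -> dxz) -> (~~ dxy -> ~~ dyz -> ~~ dxz) ->
  (cxy -> cyz -> cxz) ->
  f v = (if dxy then - v else if cxy then 0 else v1) ->
  g v = (if dyz then - v else if cyz then 0 else v2) ->
  (~~ cxy -> ~~ dxy -> f v1 = - v1) ->
  (~~ cxy -> g v1 = if dxz then - v1 else if cxz then 0 else v12) ->
  (~~ cyz -> ~~ dyz -> g v2 = - v2) ->
  (~~ cyz -> f v2 = if dxz then - v2 else if cxz then 0 else v21) ->
  (~~ cxy -> ~~ cxz -> f v12 = if dyz then - v12 else if cyz then 0 else w) ->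
  (~~ cyz -> ~~ cxz -> g v21 = if dxy then - v21 else if cxy then 0 else w) ->
  f (g (f v)) = g (f (g v)).
Proof.
move=> f0 g0 fN gN + + + fv gv.
case: dxy fv; case: dyz gv; case: dxz => gv fv t1 t2;
  try by [have := t1 isT isT | have := t2 isT isT].
all: case: cxy fv; case: cyz gv; case: cxz => gv fv t3;
  try by have := t3 isT isT.
all: move=> E1 E2 E3 E4 E5 E6.
all: try have {}E1 := E1 isT isT.
all: try have {}E2 := E2 isT.
all: try have {}E3 := E3 isT isT.
all: try have {}E4 := E4 isT.
all: try have {}E5 := E5 isT isT.
all: try have {}E6 := E6 isT isT.
all: rewrite fv gv.
all: repeat first [rewrite fN | rewrite gN | rewrite f0 | rewrite g0
  | rewrite fv | rewrite gv | rewrite E1 | rewrite E2 | rewrite E3 | rewrite E4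
  | rewrite E5 | rewrite E6 | rewrite opprK | rewrite oppr0].
all: try by [].
Qed.

Definition Q_space (K : fieldType) (a : peak_composition) : vectType K :=
  {ffun SPIT a -> K^o}.

Definition basis (K : fieldType) (a : peak_composition) (T : SPIT a) :
    Q_space K a :=
  [ffun U : SPIT a => (U == T)%:R : K^o].

Definition Q_act (K : fieldType) (a : peak_composition) (r : rel (box a))
    (i : 'I_(sumn a).-1) (T : SPIT a) : Q_space K a :=
  if i \in Des (reading r (val T)) then - basis K T
  else if insub (sact i (val T)) is Some U then basis K U else 0.

Definition Q_lin (K : fieldType) (a : peak_composition) (r : rel (box a))
    (i : 'I_(sumn a).-1) (v : Q_space K a) : Q_space K a :=
  \sum_(T : SPIT a) (v T : K) *: Q_act K r i T.

Definition Q_pi (K : fieldType) (a : peak_composition) (r : rel (box a))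
    (i : 'I_(sumn a).-1) : 'End(Q_space K a) :=
  linfun (Q_lin (K := K) r i).

Lemma Q_lin_linear (K : fieldType) (a : peak_composition) r i :
  linear (Q_lin (K := K) (a := a) r i).
Proof.
move=> c u v; rewrite /Q_lin scaler_sumr -big_split /=; apply: eq_bigr => T _.
by rewrite !ffunE scalerDl scalerA.
Qed.

Lemma basis_sum (K : fieldType) (a : peak_composition)
    (v : Q_space K a) :
  v = \sum_(T : SPIT a) (v T : K) *: basis K T.
Proof.
apply/ffunP=> U; rewrite sum_ffunE (bigD1 U) //= !ffunE eqxx.
rewrite big1 => [|T TU]; first by rewrite addr0 [RHS]mulr1.
by rewrite !ffunE eq_sym (negPf TU) scaler0.
Qed.

Lemma Q_piE (K : fieldType) (a : peak_composition) r i T :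
  Q_pi K (a := a) r i (basis K T) = Q_act K r i T.
Proof.
pose L := GRing.isLinear.Build _ _ _ _ _ (Q_lin_linear (K := K) r i).
pose f : {linear Q_space K a -> Q_space K a} :=
  HB.pack (Q_lin (K := K) r i) L.
rewrite /Q_pi (lfunE f) /= /Q_lin (bigD1 T) //= !ffunE eqxx scale1r.
by rewrite big1 ?addr0 // => U UT; rewrite !ffunE (negPf UT) scale0r.
Qed.

Definition vec (K : fieldType) (a : peak_composition) (T : filling a) :
    Q_space K a :=
  if insub T is Some U then basis K (U : SPIT a) else 0.

Lemma Q_pi_vec (K : fieldType) (a : peak_composition) r
    i (T : filling a) c d : is_SPIT T -> T c = lo i -> T d = hi i ->
  Q_pi K r i (vec K T) =
    if (pos r d < pos r c)%N then - vec K T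
    else if cov c d then 0 else vec K (sact i T).
Proof.
move=> hT Tc Td; have hT' : `[< is_SPIT T >] by apply/asboolP.
have /SPITP[Tinj _] := hT; have sT := swap_SPIT hT Tc Td.
rewrite {1 2}/vec (insubT (fun T => `[< is_SPIT T >]) hT') Q_piE /Q_act /=.
rewrite (DesE r Tinj Tc Td); case: ifP => // _; rewrite /vec.
case: (boolP (cov c d)) => hcd //; rewrite insubN //.
by apply/asboolP=> /sT; rewrite hcd.
Qed.

Lemma Q_pi_eq (K : fieldType) (a : peak_composition)
    (f g : 'End(Q_space K a)) :
  (forall T : filling a, is_SPIT T -> f (vec K T) = g (vec K T)) -> f = g.
Proof.
move=> fg; apply/lfunP=> v; rewrite (basis_sum v) !linear_sum.
apply: eq_bigr => T _; rewrite !linearZ; congr (_ *: _).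
have := fg _ (asboolW (valP T)).
by rewrite /vec valK.
Qed.

Lemma swap_cell (a : seq nat) i (T : filling a) b v :
  T b = v -> sact i T b = sperm i v.
Proof. by rewrite ffunE => ->. Qed.

Lemma swap_braid (a : seq nat) (i j : 'I_(sumn a).-1) (T : filling a) :
  j = i.+1 :> nat ->
  sact i (sact j (sact i T)) = sact j (sact i (sact j T)).
Proof.
move=> ij; apply/ffunP=> b; rewrite !ffunE /sperm.
have -> : lo j = hi i by apply: val_inj.
have ij1 : lo i != hi j by rewrite -(inj_eq val_inj) /= ij neq_ltn ltnS leqnSn.
have ij2 : hi i != hi j by rewrite -(inj_eq val_inj) /= ij neq_ltn ltnSn.
have ij3 := lo_hi i.
rewrite -!permM; congr (fun_of_perm _ _).
transitivity (tperm (lo i) (hi j)).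
  rewrite -[X in (X * _)%g](tpermV (lo i) (hi i)).
  by rewrite -/(conjg _ _) tpermJ tpermR tpermD.
rewrite -[X in (X * _)%g](tpermV (hi i) (hi j)).
by rewrite -/(conjg _ _) tpermJ tpermL tpermD // eq_sym.
Qed.

Lemma swapC (a : seq nat) (i j : 'I_(sumn a).-1) (T : filling a) :
  (i.+1 < j)%N -> sact i (sact j T) = sact j (sact i T).
Proof.
move=> ij; apply/ffunP=> b; rewrite !ffunE /sperm -!permM.
congr (fun_of_perm _ _).
have n1 : lo i != lo j by rewrite -(inj_eq val_inj) /= neq_ltn (ltnW ij).
have n2 : lo i != hi j.
  by rewrite -(inj_eq val_inj) /= neq_ltn (ltn_trans (ltnW ij)).
have n3 : hi i != lo j by rewrite -(inj_eq val_inj) /= neq_ltn ij.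
have n4 : hi i != hi j by rewrite -(inj_eq val_inj) /= neq_ltn (ltn_trans ij).
apply/commgP/conjg_fixP; rewrite tpermJ !tpermD //; by rewrite 1?eq_sym.
Qed.

Lemma Q_piN (K : fieldType) (a : peak_composition) (r : rel (box a)) i v :
  Q_pi K r i (- v) = - Q_pi K r i v.
Proof. exact: linearN. Qed.

Lemma Q_pi0 (K : fieldType) (a : peak_composition) (r : rel (box a)) i :
  Q_pi K r i 0 = 0.
Proof. exact: linear0. Qed.

Lemma Q_pi_braid (K : fieldType) (a : peak_composition) (r : rel (box a))
    (i j : 'I_(sumn a).-1) (T : filling a) :
  j = i.+1 :> nat -> is_SPIT T ->
  Q_pi K r i (Q_pi K r j (Q_pi K r i (vec K T))) =
  Q_pi K r j (Q_pi K r i (Q_pi K r j (vec K T))).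
Proof.
move=> ij hT.
have lohi : lo j = hi i by apply: val_inj.
have nij : hi i != hi j by rewrite -lohi lo_hi.
have nij' : lo i != hi j by rewrite -(inj_eq val_inj) /= ij neq_ltn ltnS leqnSn.
have ni := lo_hi i.
have [x Tx] := cell (lo i) hT; have [y Ty] := cell (hi i) hT.
have [z Tz] := cell (hi j) hT.
pose arr (U : filling a) u v w :=
  [/\ is_SPIT U, U u = lo i, U v = hi i & U w = hi j].
have Ei U u v w : arr U u v w -> Q_pi K r i (vec K U) =
    if (pos r v < pos r u)%N then - vec K U
    else if cov u v then 0 else vec K (sact i U).
  by case=> hU Uu Uv _; apply: Q_pi_vec.
have Ej U u v w : arr U u v w -> Q_pi K r j (vec K U) =
    if (pos r w < pos r v)%N then - vec K U
    else if cov v w then 0 else vec K (sact j U).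
  by case=> hU Uu Uv Uw; apply: Q_pi_vec => //; rewrite lohi.
have Ai U u v w : arr U u v w -> cov u v = false -> arr (sact i U) v u w.
  case=> hU Uu Uv Uw uv; split; first by apply/(swap_SPIT hU Uu Uv); rewrite uv.
  - by rewrite (swap_cell _ Uv) /sperm tpermR.
  - by rewrite (swap_cell _ Uu) /sperm tpermL.
  - by rewrite (swap_cell _ Uw) /sperm tpermD.
have Aj U u v w : arr U u v w -> cov v w = false -> arr (sact j U) u w v.
  case=> hU Uu Uv Uw vw; rewrite -lohi in Uv; split.
  - by apply/(swap_SPIT hU Uv Uw); rewrite vw.
  - by rewrite (swap_cell _ Uu) /sperm tpermD // 1?eq_sym // lohi.
  - by rewrite (swap_cell _ Uw) /sperm tpermR.
  - by rewrite (swap_cell _ Uv) /sperm tpermL.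
have A0 : arr T x y z by [].
have pxy : (pos r x < pos r y)%N = ~~ (pos r y < pos r x)%N.
  rewrite -leqNgt ltn_neqAle (inj_eq (@pos_inj _ r)).
  by case: eqVneq => // xy; rewrite -Tx -Ty xy eqxx in ni.
have pyz : (pos r y < pos r z)%N = ~~ (pos r z < pos r y)%N.
  rewrite -leqNgt ltn_neqAle (inj_eq (@pos_inj _ r)).
  by case: eqVneq => // yz; rewrite -Ty -Tz yz eqxx in nij.
have pxz : (pos r x < pos r z)%N = ~~ (pos r z < pos r x)%N.
  rewrite -leqNgt ltn_neqAle (inj_eq (@pos_inj _ r)).
  by case: eqVneq => // xz; rewrite -Tx -Tz xz eqxx in nij'.
have B := swap_braid T ij.
apply: (braid_cases (v1 := vec K (sact i T)) (v2 := vec K (sact j T))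
  (v12 := vec K (sact j (sact i T)))
  (v21 := vec K (sact i (sact j T)))
  (w := vec K (sact i (sact j (sact i T))))
  (dxy := (pos r y < pos r x)%N) (dyz := (pos r z < pos r y)%N)
  (dxz := (pos r z < pos r x)%N)
  (cxy := cov x y) (cyz := cov y z) (cxz := cov x z)).
- exact: Q_pi0.
- exact: Q_pi0.
- exact: Q_piN.
- exact: Q_piN.
- by move=> h h'; apply: ltn_trans h' h.
- by rewrite -pxy -pyz -pxz; apply: ltn_trans.
- exact: cov_trans.
- exact: Ei A0.
- exact: Ej A0.
- by move=> /negbTE/(Ai _ _ _ _ A0) A1 h; rewrite (Ei _ _ _ _ A1) pxy h.
- by move=> /negbTE/(Ai _ _ _ _ A0) A1; rewrite (Ej _ _ _ _ A1).
- by move=> /negbTE/(Aj _ _ _ _ A0) A2 h; rewrite (Ej _ _ _ _ A2) pyz h.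
- by move=> /negbTE/(Aj _ _ _ _ A0) A2; rewrite (Ei _ _ _ _ A2).
- move=> /negbTE/(Ai _ _ _ _ A0) A1 /negbTE/(Aj _ _ _ _ A1) A12.
  by rewrite (Ei _ _ _ _ A12).
- move=> /negbTE/(Aj _ _ _ _ A0) A2 /negbTE/(Ai _ _ _ _ A2) A21.
  by rewrite (Ej _ _ _ _ A21) B.
Qed.

Lemma Q_pi_rel (K : fieldType) (a : peak_composition) (r : rel (box a)) :
  hecke_relations (Q_pi K r).
Proof.
split=> [i|i j ij|i j ij]; apply: Q_pi_eq => T hT.
- have [c Tc] := cell (lo i) hT; have [d Td] := cell (hi i) hT.
  have E := Q_pi_vec K r hT Tc Td.
  rewrite comp_lfunE opp_lfunE E; case: ifP => [h|/negbT h].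
    by rewrite Q_piN E h.
  case: ifP => [|/negbT ncd]; first by rewrite Q_pi0 oppr0.
  have sT : is_SPIT (sact i T) by apply/(swap_SPIT hT Tc Td).
  have Sd : sact i T d = lo i by rewrite (swap_cell _ Td) /sperm tpermR.
  have Sc : sact i T c = hi i by rewrite (swap_cell _ Tc) /sperm tpermL.
  rewrite (Q_pi_vec K r sT Sd Sc) ltn_neqAle leqNgt h andbT.
  rewrite (inj_eq (@pos_inj _ r)) ifT //; apply/eqP=> cd.
  by have := lo_hi i; rewrite -Tc -Td cd eqxx.
- by rewrite !comp_lfunE; apply: Q_pi_braid.
- have [c Tc] := cell (lo i) hT; have [d Td] := cell (hi i) hT.
  have [e Te] := cell (lo j) hT; have [f Tf] := cell (hi j) hT.
  have n1 : lo i != lo j by rewrite -(inj_eq val_inj) /= neq_ltn (ltnW ij).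
  have n2 : lo i != hi j.
    by rewrite -(inj_eq val_inj) /= neq_ltn (ltn_trans (ltnW ij)).
  have n3 : hi i != lo j by rewrite -(inj_eq val_inj) /= neq_ltn ij.
  have n4 : hi i != hi j by rewrite -(inj_eq val_inj) /= neq_ltn (ltn_trans ij).
  have E := Q_pi_vec K r hT Tc Td; have F := Q_pi_vec K r hT Te Tf.
  rewrite !comp_lfunE E F.
  have Fi : cov c d = false -> Q_pi K r j (vec K (sact i T)) =
      if (pos r f < pos r e)%N then - vec K (sact i T)
      else if cov e f then 0 else vec K (sact j (sact i T)).
    move=> ncd; apply: Q_pi_vec.
    - by apply/(swap_SPIT hT Tc Td); rewrite ncd.
    - by rewrite (swap_cell _ Te) /sperm tpermD.
    - by rewrite (swap_cell _ Tf) /sperm tpermD.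
  have Ej : cov e f = false -> Q_pi K r i (vec K (sact j T)) =
      if (pos r d < pos r c)%N then - vec K (sact j T)
      else if cov c d then 0 else vec K (sact i (sact j T)).
    move=> nef; apply: Q_pi_vec.
    - by apply/(swap_SPIT hT Te Tf); rewrite nef.
    - by rewrite (swap_cell _ Tc) /sperm tpermD // eq_sym.
    - by rewrite (swap_cell _ Td) /sperm tpermD // eq_sym.
  rewrite (swapC T ij) in Ej.
  case h1: (pos r d < pos r c)%N E Ej; case h2: (pos r f < pos r e)%N F Fi;
  case cd: (cov c d); case ef: (cov e f) => F Fi E Ej;
  by rewrite ?Q_piN ?Q_pi0 ?E ?F ?Fi ?Ej // ?opprK ?oppr0 ?Q_pi0 //
    ?Q_piN ?E ?F.
Qed.

(* The action on C SPIT(a) that comes from the descents of the reading words  *)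
(* with respect to r.                                                         *)
Definition Q_module (K : fieldType) (a : peak_composition) (r : rel (box a)) :
    hecke_module K (sumn a) :=
  HeckeModule (Q_pi_rel K r).

Definition Q_c (K : fieldType) (a : peak_composition) :=
  Q_module K (@col_order a).
Definition Q_r (K : fieldType) (a : peak_composition) :=
  Q_module K (@row_order a).

(* Main.v *)
(* SPIT(a) is the set of linear extensions of the order cov, which is a chain *)
(* (the first two columns) with an arm attached in each row with more than    *)
(* two boxes. Whether i is a descent depends on the reading order only        *)
(* through the boxes occupied by i and i+1, and these are either incomparable *)
(* or form a cover of cov.                                                    *)
(* (a) Both reading orders decide the covers in the same way. Cutting         *)
(* {1, ..., n} into blocks after the elements of D, and renumbering each      *)
(* block in the other reading order, matches the tableaux with descents in D  *)
(* for the two orders, so descent sets are equidistributed. Sets of tableaux  *)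
(* closed under the arrows span submodules, whence ch is the sum of the       *)
(* fundamental functions of the descent sets.                                 *)
(* (b) With at most one arm, i is a descent for either order iff i+1 lies in  *)
(* a higher row than i. With two arms, Tsource spans the only one-dimensional *)
(* submodule of Q_r, while Q_c has a second one, spanned by Tstar.            *)
(* (c) The isomorphisms are right multiplications. If e is between the two    *)
(* readings of Tsup in the right weak order, then its left interval consists  *)
(* of the words of all tableaux read in the order in which e reads Tsup: from *)
(* any tableau one can climb to Tsource and descend to Tsup.                  *)

From HB Require Import structures.
Require Import Defs.
From mathcomp Require Import all_boot all_fingroup all_algebra.
From mathcomp Require Import complex reals.
From mathcomp Require Import boolp zify.
(* MathComp's row and col on matrices must not shadow those on boxes. *)
Import Defs.

Set Implicit Arguments.
Unset Strict Implicit.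
Unset Printing Implicit Defensive.

Local Open Scope nat_scope.

(** A tableau is a linear extension of [cov]: the first two columns form a chain, and each row with
    more than two boxes carries an arm branching off it. Everything depends on how a reading order
    treats the boxes of two consecutive entries.

    (a) All that is asked of a reading order is [compatible]. Cut the numbers after each element of
    D. A tableau with descents inside D reads increasingly within each block, so it is determined by
    the block of each box ([resort_cancel]). Re-sorting the blocks along another compatible order
    stays among the tableaux ([SPIT_resort]); induction on D then yields equal counts for each
    descent set ([card_Des_eq]). Removing tableaux one by one filters the module with
    one-dimensional quotients, which computes [ch] ([ch_Q]).

    (b) With one arm, consecutive entries move up a row exactly when they move to a smaller column
    ([adjacent_col]), so descents and actions coincide. With two arms, compare common eigenvectors
    of the generators: in [Q_r] they all lie on the line of [Tsource] ([row_eigenvector]), while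
    [Q_c] has the independent ones of [Tsource] and [Tstar] ([Tstar_sink]).

    (c) A change of reading order is a right multiplication, which commutes with the left action of
    the s_i; only descents and membership need checking. An [e] of the right interval agrees with
    the two readings wherever they agree ([pos_between]), which fixes the descents ([Des_interval])
    and turns its left interval into the set of all tableaux ([mem_interval]). *)

Lemma card_gt1_count (p : pred nat) (s : seq nat) :
  reflect (exists i j, [/\ i < j, j < size s, p (nth 0 s i) & p (nth 0 s j)])
    (1 < count p s).
Proof.
have -> : count p s = #|[pred i : 'I_(size s) | p (nth 0 s i)]|.
  by rewrite -sum1_count (big_nth 0) big_mkord sum1_card.
apply: (iffP card_gt1P) => [[i [j [pi pj]]]|[i [j [ij js pi pj]]]].
  rewrite -(inj_eq val_inj) neq_ltn /= => /orP[] ij.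
    by exists i, j.
  by exists j, i.
exists (Ordinal (ltn_trans ij js)), (Ordinal js).
by split; rewrite ?inE //= -(inj_eq val_inj) /= neq_ltn ij.
Qed.

(** * Boxes, and fillings determined by the order of their entries *)

Section Boxes.
Variable a : seq nat.
Implicit Types b c d x y : box a.

Lemma ltn_row b : row b < size a.
Proof. exact: ltn_ord (tag b). Qed.

Lemma ltn_col b : col b < nth 0 a (row b).
Proof. exact: ltn_ord (tagged b). Qed.

Lemma ex_box i j : i < size a -> j < nth 0 a i ->
  exists b : box a, row b = i /\ col b = j.
Proof.
move=> hi hj; exists (existT (fun i : 'I_(size a) => 'I_(nth 0 a i))
  (Ordinal hi) (Ordinal (hj : j < nth 0 a (Ordinal hi)))).
by [].
Qed.

Lemma ex_box_left b j : j <= col b ->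
  exists b' : box a, row b' = row b /\ col b' = j.
Proof.
move=> h; apply: ex_box (ltn_row b) _; exact: leq_ltn_trans h (ltn_col b).
Qed.

Lemma box_neq b b' : b != b' -> (row b != row b') || (col b != col b').
Proof.
apply: contraNT; rewrite negb_or !negbK => /andP[/eqP r /eqP c].
by rewrite (box_eq r c).
Qed.

Lemma fill_onto (T : filling a) v : injective T -> exists b, T b = v.
Proof.
move=> Tinj; have : v \in codom T.
  by apply: inj_card_onto => //; rewrite card_box card_ord.
by case/codomP=> b ->; exists b.
Qed.

Lemma fill_rank (T : filling a) b : injective T ->
  T b = #|[set b' | T b' < T b]| :> nat.
Proof.
move=> Tinj; rewrite -(card_imset _ Tinj).
have -> : [set T x | x in [set b' | T b' < T b]] =
  [set v : 'I_(sumn a) | v < T b].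
  apply/setP=> v; rewrite inE; apply/imsetP/idP=> [[x]|vb].
    by rewrite inE => xb ->.
  by have [x xv] := fill_onto v Tinj; exists x; rewrite ?inE xv.
rewrite cardsE -sum1_card.
rewrite -(big_ord_widen _ (fun=> 1)) ?sum1_card ?card_ord //.
exact: ltnW.
Qed.

Lemma eq_fill (T U : filling a) : injective T -> injective U ->
  (forall x y, T x < T y -> U x < U y) -> T = U.
Proof.
move=> Tinj Uinj TU; apply/ffunP=> b; apply: val_inj.
rewrite /= fill_rank // [RHS]fill_rank //; apply: eq_card => x; rewrite !inE.
apply/idP/idP=> [|Uxb]; first exact: TU.
case: ltngtP => // [/TU|/val_inj/Tinj xb].
  by rewrite ltnNge (ltnW Uxb).
by rewrite xb ltnn in Uxb.
Qed.

(** Entries are compared through a run of consecutive values. With [eq_fill], this lets a local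
    condition on the boxes of i and i+1 identify a whole tableau. *)
Lemma adjacent_mono (T : filling a) (k : box a -> nat) : injective T ->
  (forall i c d, T c = lo i -> T d = hi i -> k c < k d) ->
  forall x y, T x < T y -> k x < k y.
Proof.
move=> Tinj adj x y; have [m] := ubnP (T y); elim: m y => // m IH y ym xy.
have hv : (T y).-1 < (sumn a).-1 by have := ltn_ord (T y); lia.
have [z Tz] := fill_onto (lo (Ordinal hv)) Tinj.
have zy : k z < k y.
  have Ty : T y = hi (Ordinal hv) by apply: val_inj => /=; lia.
  exact: adj Tz Ty.
have Tzy : T z = (T y).-1 :> nat by rewrite Tz.
have [xz|] := ltnP (T x) (T z); first by apply: ltn_trans zy; apply: IH; lia.
move=> zx; have -> : x = z by apply/Tinj/val_inj => /=; lia.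
by [].
Qed.

Definition rank_fill (k : box a -> nat) : filling a :=
  fill (fun b => #|[set b' | k b' < k b]|.+1).

Lemma rank_fillE k b : rank_fill k b = #|[set b' | k b' < k b]| :> nat.
Proof.
have : entry (rank_fill k) b = #|[set b' | k b' < k b]|.+1.
  rewrite fillE //= -card_box -cardsT; apply: proper_card.
  by rewrite properT; apply/negP=> /eqP/setP/(_ b); rewrite !inE ltnn.
by case.
Qed.

Lemma rank_fill_lt k x y : k x < k y -> rank_fill k x < rank_fill k y.
Proof.
move=> xy; rewrite !rank_fillE; apply: proper_card; apply/properP; split.
  by apply/subsetP=> z; rewrite !inE => /ltn_trans; apply.
by exists x; rewrite !inE ?ltnn.
Qed.

Lemma rank_fill_inj k : injective k -> injective (rank_fill k).
Proof.
move=> kinj x y /(congr1 val) /= xy; apply: kinj.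
by case: (ltngtP (k x) (k y)) => // /rank_fill_lt; rewrite xy ltnn.
Qed.

Lemma rank_fill_mono k x y : injective k ->
  (rank_fill k x < rank_fill k y) = (k x < k y).
Proof.
move=> kinj; apply/idP/idP=> [|/rank_fill_lt//].
case: (ltngtP (k x) (k y)) => // [/rank_fill_lt yx xy|/kinj->];
  last by rewrite ltnn.
by have := ltn_trans yx xy; rewrite ltnn.
Qed.

End Boxes.

(** * Positions in the two reading orders *)

Section Positions.
Variable a : seq nat.

Lemma pos_leE (r : rel (box a)) x y :
  total r -> transitive r -> antisymmetric r -> (pos r x <= pos r y) = r x y.
Proof.
move=> rt rtr ra.
have mem z : z \in sort r (enum {: box a}) by rewrite mem_sort mem_enum.
have le u v : pos r u <= pos r v -> r u v.
  have rr z : r z z by have := rt z z; rewrite orbb.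
  exact: (sorted_leq_index rtr rr (sort_sorted rt _) u v (mem u) (mem v)).
apply/idP/idP=> [|xy]; first exact: le.
case: leqP => // yx.
have xy' : x = y by apply: ra; rewrite xy (le _ _ (ltnW yx)).
by rewrite xy' ltnn in yx.
Qed.

Lemma pos_ltE (r : rel (box a)) x y :
  total r -> transitive r -> antisymmetric r -> (pos r x < pos r y) = ~~ r y x.
Proof. by move=> rt rtr ra; rewrite ltnNge pos_leE. Qed.

Lemma pos_col_lt x y : (pos (@col_order a) x < pos (@col_order a) y) =
  (col x < col y) || ((col x == col y) && (row x < row y)).
Proof.
rewrite pos_ltE /col_order => [|u v|u v w|u v]; try lia.
move=> uv; apply: box_eq; lia.
Qed.

Lemma pos_row_lt x y : (pos (@row_order a) x < pos (@row_order a) y) =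
  (row y < row x) || ((row x == row y) && (col x < col y)).
Proof.
rewrite pos_ltE /row_order => [|u v|u v w|u v]; try lia.
move=> uv; apply: box_eq; lia.
Qed.

End Positions.

(** * The poset [cov], and the tableaux [Tsource] and [Tsup] *)

Section Peak.
Variable a : peak_composition.
Implicit Types (b c d x y : box a) (T : filling a).

Lemma ex_box_below r b j : r < row b -> j <= 1 ->
  exists b', row b' = r /\ col b' = j :> nat.
Proof.
move=> rb j1; have hr : r.+1 < size a := leq_ltn_trans rb (ltn_row b).
apply: ex_box; first exact: ltnW.
have /andP[_ /(all_nthP 0)] := parts_peak a; move/(_ r).
rewrite size_take_min leq_min [r < size a]ltnW // andbT.
have -> : r < (size a).-1 by lia.
by move/(_ isT); rewrite nth_take; [exact: leq_ltn_trans | lia].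
Qed.

Lemma SPIT_inj T : is_SPIT T -> injective T.
Proof. by case/SPITP. Qed.

Lemma SPIT_cov T c d : is_SPIT T -> cov c d -> T c < T d.
Proof. by case/SPITP=> _; apply. Qed.

Lemma SPIT_ncov T c d : is_SPIT T -> T c < T d -> ~~ cov d c.
Proof. by move=> hT cd; apply/negP=> /(SPIT_cov hT); lia. Qed.

(** The second box of the row of [c] and the first box of the row of [d] lie weakly between [c] and
    [d] in [cov]; consecutive entries leave no room, so they are [c] and [d] themselves. *)
Lemma adjacent_up T i c d : is_SPIT T -> T c = lo i -> T d = hi i ->
  row c < row d -> col c <= 1 -> col c = 1 /\ col d = 0.
Proof.
move=> hT Tc Td rcd cc.
have [c1 [rc1 cc1]] := ex_box_below rcd (leqnn 1).
have [d0 [rd0 cd0]] := ex_box_left (leq0n (col d)).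
have le_c : T c <= T c1.
  have [->//|ne] := eqVneq c c1; apply/ltnW/(SPIT_cov hT).
  by move: (box_neq ne); rewrite /cov; lia.
have le_d : T d0 <= T d.
  have [->//|ne] := eqVneq d d0; apply/ltnW/(SPIT_cov hT).
  by move: (box_neq ne); rewrite /cov; lia.
have lt_m : T c1 < T d0 by apply: (SPIT_cov hT); rewrite /cov; lia.
have vc : T c = i :> nat by rewrite Tc.
have vd : T d = i.+1 :> nat by rewrite Td.
have -> : c = c1 by apply/(SPIT_inj hT)/val_inj => /=; lia.
have -> : d = d0 by apply/(SPIT_inj hT)/val_inj => /=; lia.
by [].
Qed.

Lemma Tsource_val b : Tsource a b = sumn (take (row b) a) + col b :> nat.
Proof.
have : entry (Tsource a) b = (sumn (take (row b) a) + col b).+1.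
  rewrite fillE //=.
  have : sumn (take (row b).+1 a) + sumn (drop (row b).+1 a) = sumn a.
    by rewrite -sumn_cat cat_take_drop.
  rewrite (take_nth 0) ?ltn_row // sumn_rcons.
  have := ltn_col b; lia.
by case.
Qed.

Lemma sumn_take_mono (s : seq nat) i j :
  i <= j -> sumn (take i s) <= sumn (take j s).
Proof.
by move=> ij; rewrite -(subnKC ij) takeD sumn_cat leq_addr.
Qed.

Lemma Tsource_row c d : row c < row d -> Tsource a c < Tsource a d.
Proof.
move=> cd; rewrite !Tsource_val; have := sumn_take_mono a cd.
rewrite (take_nth 0) ?ltn_row // sumn_rcons; have := ltn_col c; lia.
Qed.

Lemma Tsource_col c d : row c = row d -> col c < col d ->
  Tsource a c < Tsource a d.
Proof. by move=> rcd; rewrite !Tsource_val rcd; lia. Qed.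

Lemma SPIT_Tsource : is_SPIT (Tsource a).
Proof.
apply/SPITP; split=> [x y xy|x y].
  apply: box_eq; last first.
    case: (ltngtP (row x) (row y)) => [/Tsource_row|/Tsource_row|rxy];
      rewrite ?xy ?ltnn //.
    case: (ltngtP (col x) (col y)) => // /Tsource_col; rewrite xy ltnn.
      by move/(_ rxy).
    by move/(_ (esym rxy)).
  by case: (ltngtP (row x) (row y)) => // /Tsource_row; rewrite xy ltnn.
rewrite /cov => /orP[/andP[/eqP]|/andP[/Tsource_row//]].
exact: Tsource_col.
Qed.

(** Each number up to the left-hand side is [2 * row + col] for some box of the first two columns,
    which injects these numbers into those boxes. Hence [Tsup] fills the two columns with numbers
    below those of the arms. *)
Lemma Tsup_bound b : col b < 2 ->
  (row b).*2 + col b < #|[set b' : box a | col b' < 2]|.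
Proof.
move=> b2; set k := _ + _.
have exb (i : 'I_k.+1) : {b' : box a | (row b').*2 + col b' = i & col b' < 2}.
  apply/cid2; have [ik|ik] := leqP ((row b).*2) i.
    have ci : i - (row b).*2 <= col b by have := ltn_ord i; rewrite /k; lia.
    have [b' [rb cb]] := ex_box_left ci; exists b'; lia.
  have ri : i./2 < row b by lia.
  have [|b' [rb cb]] := @ex_box_below i./2 b (odd i) ri; first by case: odd.
  by exists b'; rewrite ?rb ?cb; lia.
pose f i := s2val (exb i).
have finj : injective f.
  move=> i j ij; apply: val_inj => /=.
  by rewrite -(s2valP (exb i)) -(s2valP (exb j)) -/(f i) ij.
rewrite -[X in X <= _](card_ord k.+1) -cardsT -(card_imset _ finj).
apply/subset_leq_card/subsetP=> _ /imsetP[i _ ->].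
by rewrite inE; exact: s2valP' (exb i).
Qed.

Lemma Tsup_val b : Tsup a b = (if col b < 2 then (row b).*2 + col b else
   (#|[set b' : box a | col b' < 2]| +
    #|[set b' : box a | (2 <= col b') && col_order b' b]|).-1) :> nat.
Proof.
have -> : (Tsup a b : nat) = (entry (Tsup a) b).-1 by [].
have card_le : #|[set b' : box a | col b' < 2]| +
    #|[set b' : box a | 2 <= col b']| <= sumn a.
  rewrite -card_box -(cardC [set b' : box a | col b' < 2]) leq_add2l.
  by apply/eq_leq/eq_card=> x; rewrite !inE -leqNgt.
rewrite fillE.
  by case: ifP => [/eqP->|b0]; [|case: ifP => [/eqP->|b1]];
    rewrite ?addn0 ?addn1 //; case: ltnP => //; lia.
case: ifP => [/eqP c0|b0]; [|case: ifP => [/eqP c1|b1]].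
- have := @Tsup_bound b; rewrite c0 => /(_ isT); lia.
- have := @Tsup_bound b; rewrite c1 => /(_ isT); lia.
rewrite addn_gt0; apply/andP; split.
  apply/orP; right; apply/card_gt0P; exists b; rewrite inE /col_order; lia.
apply: leq_trans card_le; rewrite leq_add2l; apply: subset_leq_card.
by apply/subsetP=> x; rewrite !inE => /andP[].
Qed.

Lemma Tsup_left c d : col c < 2 -> col d < 2 ->
  (Tsup a c < Tsup a d) = ((row c).*2 + col c < (row d).*2 + col d).
Proof. by move=> c2 d2; rewrite !Tsup_val c2 d2. Qed.

Lemma Tsup_left_right c d : col c < 2 -> 2 <= col d -> Tsup a c < Tsup a d.
Proof.
move=> c2 d2; rewrite !Tsup_val c2 [col d < 2]ltnNge d2 /=.
have := Tsup_bound c2.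
have : 0 < #|[set b' : box a | (2 <= col b') && col_order b' d]|.
  by apply/card_gt0P; exists d; rewrite inE /col_order; lia.
by move: #|_| #|_| => p q; lia.
Qed.

Lemma Tsup_right c d : 2 <= col c ->
  (col c < col d) || ((col c == col d) && (row c < row d)) ->
  Tsup a c < Tsup a d.
Proof.
move=> c2 cd; rewrite !Tsup_val [col c < 2]ltnNge [col d < 2]ltnNge c2.
have -> /= : 2 <= col d by lia.
set m := #|_|; set p := #|_|; set q := #|_|.
have p0 : 0 < p by apply/card_gt0P; exists c; rewrite inE /col_order; lia.
suff : p < q by clearbody m p q; lia.
apply: proper_card; apply/properP; split.
  by apply/subsetP=> z; rewrite !inE /col_order; lia.
by exists d; rewrite !inE /col_order; lia.
Qed.

Lemma SPIT_Tsup : is_SPIT (Tsup a).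
Proof.
have tot x y : x != y -> (Tsup a x < Tsup a y) || (Tsup a y < Tsup a x).
  move=> xy; have := box_neq xy.
  have [x2|x2] := ltnP (col x) 2; have [y2|y2] := ltnP (col y) 2.
  - by rewrite !Tsup_left //; lia.
  - by rewrite (Tsup_left_right x2 y2).
  - by rewrite (Tsup_left_right y2 x2) orbT.
  - case: (boolP ((col x < col y) || ((col x == col y) && (row x < row y)))).
      by move/(Tsup_right x2) ->.
    by move=> h1 h2; rewrite (@Tsup_right y x y2) ?orbT //; lia.
apply/SPITP; split=> [x y xy|x y].
  by apply/eqP/negPn/negP=> /tot; rewrite xy ltnn.
rewrite /cov => xy.
have [x2|x2] := ltnP (col x) 2; have [y2|y2] := ltnP (col y) 2.
- by rewrite Tsup_left //; lia.
- exact: Tsup_left_right.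
- lia.
- by apply: Tsup_right => //; lia.
Qed.

End Peak.


(** * Weak orders through inversion sets *)

Section WeakOrder.
Variable n : nat.
Implicit Types (i : 'I_n.-1) (s t g h u : 'S_n).

Lemma perm_compE s t x : perm_comp s t x = s (t x).
Proof. by rewrite /perm_comp permM. Qed.

Lemma spermK i : involutive (sperm i).
Proof. exact: tpermK. Qed.

Lemma sperm_compK i s : perm_comp (sperm i) (perm_comp (sperm i) s) = s.
Proof. by apply/permP=> x; rewrite !perm_compE spermK. Qed.

Lemma sperm_comp_inv i s x :
  (perm_comp (sperm i) s)^-1%g x = (s^-1)%g (sperm i x).
Proof.
apply: (@perm_inj _ (perm_comp (sperm i) s)).
by rewrite permKV perm_compE permKV spermK.
Qed.

Lemma Des_sperm i s : (i \in Des (perm_comp (sperm i) s)) = (i \notin Des s).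
Proof.
rewrite !inE !sperm_comp_inv /sperm tpermL tpermR -leqNgt ltn_neqAle.
by rewrite (inj_eq (@ord_inj _)) (inj_eq perm_inj) lo_hi.
Qed.

Lemma sperm_mono i (x y : 'I_n) :
  x < y -> ~~ ((x == lo i) && (y == hi i)) -> sperm i x < sperm i y.
Proof.
rewrite -!(inj_eq val_inj) /sperm /= => xy nxy.
case: tpermP => [Ex|Ex|/eqP + /eqP +]; case: tpermP => [Ey|Ey|/eqP + /eqP +];
  rewrite -?(inj_eq val_inj) /=; move: xy nxy; rewrite ?Ex ?Ey /=; lia.
Qed.

(* Inversions are recorded by positions: they grow in the left weak order;    *)
(* those of the inverse, recorded by values, grow in the right one.           *)
Definition pinv g : {set 'I_n * 'I_n} :=
  [set pq : 'I_n * 'I_n | (pq.1 < pq.2) && (g pq.2 < g pq.1)].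

Lemma pinv_cover i s : i \notin Des s ->
  pinv s \proper pinv (perm_comp (sperm i) s).
Proof.
rewrite inE -leqNgt => di.
have neq : (s^-1)%g (lo i) != (s^-1)%g (hi i).
  by rewrite (inj_eq perm_inj) lo_hi.
have {neq} di' : (s^-1)%g (lo i) < (s^-1)%g (hi i).
  by rewrite ltn_neqAle (inj_eq (@ord_inj _)) neq.
apply/properP; split.
  apply/subsetP=> -[p q]; rewrite !inE /= => /andP[pq inv].
  rewrite pq !perm_compE sperm_mono //; apply/negP=> /andP[/eqP ql /eqP ph].
  by move: di'; rewrite -ql -ph !permK; lia.
exists ((s^-1)%g (lo i), (s^-1)%g (hi i)); rewrite !inE /= ?di' /=.
  by rewrite !perm_compE !permKV /sperm tpermL tpermR /=.
by rewrite !permKV -leqNgt /=.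
Qed.

Lemma le_L_pinv g h : le_L g h -> pinv g \subset pinv h.
Proof.
case/connectP=> p; elim: p g => [|s p IH] g /=; first by move=> _ ->.
case/andP=> /existsP[i /andP[di /eqP->]] /IH{}IH /IH.
exact/subset_trans/proper_sub/pinv_cover.
Qed.

Lemma cover_R_inv s t : cover_R s t -> cover_L s^-1%g t^-1%g.
Proof.
case/existsP=> i /andP[di /eqP->]; apply/existsP; exists i; apply/andP; split.
  by rewrite inE invgK -leqNgt ltnW.
by rewrite /perm_comp invMg /sperm tpermV.
Qed.

Lemma le_R_inv s t : le_R s t -> le_L s^-1%g t^-1%g.
Proof.
case/connectP=> p; elim: p s => [|u p IH] s /=.
  by move=> _ ->; apply: connect0.
case/andP=> /cover_R_inv/connect1 su /IH{}IH /IH.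
exact: connect_trans su.
Qed.

(** If i is a descent, applying s_i strictly loses inversions, so the result cannot be above [g]. *)
Lemma arrowE i g g' :
  arrow i g g' = (i \notin Des g) && (perm_comp (sperm i) g == g').
Proof.
rewrite /arrow; case: eqP => [<-|_]; last by rewrite !andbF.
rewrite !andbT; apply/idP/idP=> [/le_L_pinv sub|di].
  apply/negP=> di; have := @pinv_cover i (perm_comp (sperm i) g).
  by rewrite Des_sperm di sperm_compK => /(_ isT); rewrite properE sub andbF.
by apply/connect1/existsP; exists i; rewrite di eqxx.
Qed.

(** Right multiplication commutes with left multiplication by s_i, and by [arrowE] an arrow is
    otherwise a matter of descents. *)
Lemma dp_isomorphic_mulr (I1 I2 : {set 'S_n}) u :
  (forall g, (g \in I1) = (perm_comp g u \in I2)) ->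
  {in I1, forall g, Des (perm_comp g u) = Des g} -> dp_isomorphic I1 I2.
Proof.
move=> memI desI; exists (fun g => perm_comp g u) => //.
have inj : injective (fun g => perm_comp g u).
  by move=> g h /mulgI.
split.
- by move=> g h _ _ /inj.
- apply/setP=> h; apply/imsetP/idP=> [[g gI ->]|hI]; first by rewrite -memI.
  have E : h = perm_comp (perm_comp h u^-1%g) u by rewrite /perm_comp mulKVg.
  by exists (perm_comp h u^-1%g); rewrite // memI -E.
move=> g g' gI gI' i; rewrite !arrowE desI //; congr (_ && _).
rewrite -(inj_eq inj); congr (_ == _).
by rewrite /perm_comp mulgA.
Qed.

End WeakOrder.

(** * Descents of the row reading *)

Section Tableaux.
Variable a : peak_composition.
Implicit Types (b c d x y : box a) (T U : filling a) (i : 'I_(sumn a).-1).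

Lemma Des_row_order T i c d : is_SPIT T -> T c = lo i -> T d = hi i ->
  (i \in Des (w_r T)) = (row c < row d).
Proof.
move=> hT Tc Td; rewrite (DesE _ (SPIT_inj hT) Tc Td) pos_row_lt.
have cd : T c < T d by rewrite Tc Td /=.
by have := SPIT_ncov hT cd; rewrite /cov; lia.
Qed.

(** Consecutive entries either go to a higher row or are related by [cov], and [Tsource] increases
    in both cases. So from any other tableau a swap leads upwards. *)
Lemma Tsource_unique T : is_SPIT T ->
  (forall i c d, T c = lo i -> T d = hi i -> row d <= row c -> cov c d) ->
  T = Tsource a.
Proof.
move=> hT H; apply: (eq_fill (SPIT_inj hT) (SPIT_inj (SPIT_Tsource a))) => x y.
apply: (adjacent_mono (SPIT_inj hT) (k := fun b => Tsource a b)).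
move=> i c d Tc Td; have [|/(H _ _ _ Tc Td)] := ltnP (row c) (row d).
  exact: Tsource_row.
exact: SPIT_cov (SPIT_Tsource a).
Qed.

Lemma not_Tsource T : is_SPIT T -> T <> Tsource a -> exists i c d,
  [/\ T c = lo i, T d = hi i, row d <= row c & ~~ cov c d].
Proof.
move=> hT neq; apply/not_existsP => H; apply: neq; apply: Tsource_unique => //.
move=> i c d Tc Td dc; apply/negPn/negP=> ncov.
by apply: (H i); exists c, d.
Qed.

(** * At most one arm: descents, and left intervals as sets of tableaux *)

Section OneArm.
Hypothesis one_arm : count (ltn 2) a <= 1.

Lemma arm_row c d : 2 <= col c -> 2 <= col d -> row c = row d.
Proof.
have lt2 b b' : row b < row b' -> 2 <= col b -> 2 <= col b' -> False.
  move=> bb' b2 b2'; have /negP[] : ~~ (1 < count (ltn 2) a) by rewrite -leqNgt.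
  apply/card_gt1_count; exists (row b), (row b'); split=> //;
    first exact: ltn_row.
  - exact: leq_ltn_trans b2 (ltn_col b).
  - exact: leq_ltn_trans b2' (ltn_col b').
move=> c2 d2; case: (ltngtP (row c) (row d)) => // /lt2.
  by move/(_ c2 d2).
by move/(_ d2 c2).
Qed.

(** Going up a row, either [adjacent_up] gives columns 1 and 0, or [c] is in the only arm and [d] is
    not. Going down, [d] must be in the arm, as otherwise [cov d c], and then [c] is not. *)
Lemma adjacent_col T i c d : is_SPIT T -> T c = lo i -> T d = hi i ->
  (col d < col c) = (row c < row d) /\ col c != col d.
Proof.
move=> hT Tc Td; have cd : T c < T d by rewrite Tc Td /=.
have ncov := SPIT_ncov hT cd.
have [rcd|rdc|rcd] := ltngtP (row c) (row d).
- have [c1|c2] := leqP (col c) 1.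
    by have [-> ->] := adjacent_up hT Tc Td rcd c1.
  have [d1|d2] := leqP (col d) 1; first lia.
  by have := arm_row c2 d2; lia.
- have d2 : 2 <= col d by move: ncov; rewrite /cov; lia.
  have [c1|c2] := leqP (col c) 1; first lia.
  by have := arm_row c2 d2; lia.
have ne : c != d by apply/eqP=> E; move: cd; rewrite E ltnn.
by move: ncov (box_neq ne); rewrite /cov; lia.
Qed.

Lemma Des_col_order T i c d : is_SPIT T -> T c = lo i -> T d = hi i ->
  (i \in Des (w_c T)) = (row c < row d).
Proof.
move=> hT Tc Td; rewrite (DesE _ (SPIT_inj hT) Tc Td) pos_col_lt.
have [] := adjacent_col hT Tc Td; lia.
Qed.

Lemma Des_agree T : is_SPIT T -> Des (w_c T) = Des (w_r T).
Proof.
move=> hT; apply/setP=> i; have [c Tc] := cell (lo i) hT.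
have [d Td] := cell (hi i) hT.
by rewrite (Des_col_order hT Tc Td) (Des_row_order hT Tc Td).
Qed.

(** A consecutive pair outside [cov] must go down a row, hence into the arm from the first two
    columns; [Tsup] increases there because it fills those columns first. *)
Lemma Tsup_unique T : is_SPIT T ->
  (forall i c d, T c = lo i -> T d = hi i -> row c < row d -> cov c d) ->
  T = Tsup a.
Proof.
move=> hT H; apply: (eq_fill (SPIT_inj hT) (SPIT_inj (SPIT_Tsup a))) => x y.
apply: (adjacent_mono (SPIT_inj hT) (k := fun b => Tsup a b)).
move=> i c d Tc Td; case: (boolP (cov c d)) => [|ncd].
  exact: SPIT_cov (SPIT_Tsup a).
have cd : T c < T d by rewrite Tc Td /=.
have ncov := SPIT_ncov hT cd.
have ne : c != d by apply/eqP=> E; move: cd; rewrite E ltnn.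
have rdc : row d < row c.
  case: (ltngtP (row c) (row d)) => // [/(H _ _ _ Tc Td)|];
    first by rewrite (negPf ncd).
  by move: ncov ncd (box_neq ne); rewrite /cov; lia.
have d2 : 2 <= col d by move: ncov; rewrite /cov; lia.
apply: Tsup_left_right => //; rewrite ltnNge; apply/negP=> c2.
by have := arm_row c2 d2; lia.
Qed.

Lemma not_Tsup T : is_SPIT T -> T <> Tsup a -> exists i c d,
  [/\ T c = lo i, T d = hi i, row c < row d & ~~ cov c d].
Proof.
move=> hT neq; apply/not_existsP => H; apply: neq; apply: Tsup_unique => //.
move=> i c d Tc Td dc; apply/negPn/negP=> ncov.
by apply: (H i); exists c, d.
Qed.

(* The filling whose word is g when it is read in the order in which reading  *)
(* Tsup gives e.                                                              *)
Definition unread (e g : 'S_(sumn a)) : filling a :=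
  [ffun b => g ((e^-1)%g (Tsup a b))].

Lemma unreadE e g b : unread e g b = g ((e^-1)%g (Tsup a b)).
Proof. by rewrite ffunE. Qed.

Let xi := perm_comp (w_c (Tsource a)) (w_c (Tsup a))^-1%g.

Lemma unread_inj e g : injective (unread e g).
Proof.
by move=> x y; rewrite !unreadE => /perm_inj/perm_inj/(SPIT_inj (SPIT_Tsup a)).
Qed.

Lemma unread_perm_inj e : injective (unread e).
Proof.
move=> g h /ffunP gh; apply/permP=> p.
have [b bp] := fill_onto (e p) (SPIT_inj (SPIT_Tsup a)).
by have := gh b; rewrite !unreadE bp permK.
Qed.

Lemma unread_sperm e i g :
  unread e (perm_comp (sperm i) g) = sact i (unread e g).
Proof. by apply/ffunP=> b; rewrite [RHS]ffunE !unreadE perm_compE. Qed.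

Lemma unread_Tsup e : unread e e = Tsup a.
Proof. by apply/ffunP=> b; rewrite unreadE permKV. Qed.

(** [xi] maps the entry of each box in [Tsup] to its entry in [Tsource], whatever the reading
    order. *)
Lemma unread_Tsource e : unread e (perm_comp xi e) = Tsource a.
Proof.
apply/ffunP=> b; rewrite unreadE !perm_compE permKV.
rewrite -(readingE (@col_order a) b (SPIT_inj (SPIT_Tsup a))) permK.
exact: readingE (SPIT_inj (SPIT_Tsource a)).
Qed.

Lemma Des_unread e g i c d : unread e g c = lo i -> unread e g d = hi i ->
  (i \in Des g) = ((e^-1)%g (Tsup a d) < (e^-1)%g (Tsup a c)).
Proof. by rewrite !unreadE inE => <- <-; rewrite !permK. Qed.

Section Interval.
Variable e : 'S_(sumn a).
Hypothesis eI : e \in int_R (w_c (Tsup a)) (w_r (Tsup a)).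

Lemma inv_reading (r : rel (box a)) b :
  ((reading r (Tsup a))^-1)%g (Tsup a b) = pos r b :> nat.
Proof.
by rewrite -(readingE r b (SPIT_inj (SPIT_Tsup a))) permK.
Qed.

(** Recorded by values, the inversions of [e] contain those of the column word of [Tsup] and are
    contained in those of its row word. The first inclusion settles the case [Tsup y < Tsup x], the
    second the case [Tsup x < Tsup y]. *)
Lemma pos_between x y :
  pos (@col_order a) x < pos (@col_order a) y ->
  pos (@row_order a) x < pos (@row_order a) y ->
  (e^-1)%g (Tsup a x) < (e^-1)%g (Tsup a y).
Proof.
move: eI; rewrite inE => /andP[/le_R_inv/le_L_pinv/subsetP ce].
move=> /le_R_inv/le_L_pinv/subsetP er cxy rxy.
have nexy : Tsup a x != Tsup a y.
  by apply: contraTneq cxy => /(SPIT_inj (SPIT_Tsup a)) ->; rewrite ltnn.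
case: (ltngtP (Tsup a x) (Tsup a y)) => [xy|yx|/val_inj E]; last first.
- by rewrite E eqxx in nexy.
- have /ce : (Tsup a y, Tsup a x) \in pinv (w_c (Tsup a))^-1%g.
    by rewrite inE /= yx !inv_reading.
  by rewrite inE => /andP[].
rewrite ltnNge; apply/negP;
  rewrite leq_eqVlt (inj_eq (@ord_inj _)) (inj_eq perm_inj).
rewrite eq_sym (negPf nexy) /= => yx.
have /er : (Tsup a x, Tsup a y) \in pinv e^-1%g by rewrite inE /= xy.
by rewrite inE /= xy !inv_reading; lia.
Qed.

(** The column and row readings order the boxes of i and i+1 in the same way, so [e] has no
    choice. *)
Lemma Des_interval g i c d : is_SPIT (unread e g) ->
  unread e g c = lo i -> unread e g d = hi i -> (i \in Des g) = (row c < row d).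
Proof.
move=> hT Tc Td; rewrite (Des_unread Tc Td).
have ne : (e^-1)%g (Tsup a d) != (e^-1)%g (Tsup a c).
  rewrite !(inj_eq perm_inj) (inj_eq (SPIT_inj (SPIT_Tsup a))).
  by apply/eqP=> E; have := lo_hi i; rewrite -Tc -Td E eqxx.
have Dc := DesE (@col_order a) (SPIT_inj hT) Tc Td.
have Dr := DesE (@row_order a) (SPIT_inj hT) Tc Td.
have Nc : (pos (@col_order a) c < pos (@col_order a) d) =
  ~~ (pos (@col_order a) d < pos (@col_order a) c).
  rewrite -leqNgt ltn_neqAle (inj_eq (@pos_inj _ _)); case: eqP => // E.
  by rewrite E eqxx in ne.
have Nr : (pos (@row_order a) c < pos (@row_order a) d) =
  ~~ (pos (@row_order a) d < pos (@row_order a) c).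
  rewrite -leqNgt ltn_neqAle (inj_eq (@pos_inj _ _)); case: eqP => // E.
  by rewrite E eqxx in ne.
have E1 := Des_col_order hT Tc Td; have E2 := Des_row_order hT Tc Td.
rewrite /w_c Dc in E1; rewrite /w_r Dr in E2.
case cd : (row c < row d).
  by apply: pos_between; rewrite ?E1 ?E2.
apply/negbTE; rewrite -leqNgt; apply/ltnW/pos_between.
  by rewrite Nc E1 cd.
by rewrite Nr E2 cd.
Qed.

(** If [cov x y], both [Tsup] and [Tsource], the tableaux of the two ends, increase from [x] to [y].
    If [e] reads [x] first, an inversion of [g] there would persist at the top end; if it reads [y]
    first, the inversion of [e] there persists in [g]. The converse joins a tableau to both ends by
    legal swaps. *)
Lemma mem_interval g :
  (g \in int_L e (perm_comp xi e)) = `[< is_SPIT (unread e g) >].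
Proof.
rewrite inE; apply/idP/asboolP=> [/andP[eg gx]|hT].
  have sub1 := subsetP (le_L_pinv eg); have sub2 := subsetP (le_L_pinv gx).
  apply/SPITP; split=> [|x y xy]; first exact: unread_inj.
  have pE (h : 'S_(sumn a)) b : h ((e^-1)%g (Tsup a b)) = unread e h b.
    by rewrite unreadE.
  have xy_sup := SPIT_cov (SPIT_Tsup a) xy.
  have xy_source := SPIT_cov (SPIT_Tsource a) xy.
  have nexy : x != y by apply: contraTneq xy_sup => ->; rewrite ltnn.
  have ne : (e^-1)%g (Tsup a x) != (e^-1)%g (Tsup a y).
    by rewrite (inj_eq perm_inj) (inj_eq (SPIT_inj (SPIT_Tsup a))).
  case: (ltngtP ((e^-1)%g (Tsup a x)) ((e^-1)%g (Tsup a y)))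
    => [lt|lt|/val_inj E].
  - rewrite ltnNge leq_eqVlt (inj_eq (@ord_inj _)) (inj_eq (@unread_inj _ _)).
    rewrite eq_sym.
    rewrite (negPf nexy) /=; apply/negP=> yx.
    have /sub2 : ((e^-1)%g (Tsup a x), (e^-1)%g (Tsup a y)) \in pinv g.
      by rewrite inE /= lt !pE.
    by rewrite inE /= lt !pE unread_Tsource; lia.
  - have /sub1 : ((e^-1)%g (Tsup a y), (e^-1)%g (Tsup a x)) \in pinv e.
      by rewrite inE /= lt !pE unread_Tsup.
    by rewrite inE /= lt !pE.
  - by rewrite E eqxx in ne.
apply/andP; split.
  (* Down to [Tsup]: any other tableau has a descent whose swap is legal, and the swap loses
     inversions. *)
  have [m] := ubnP #|pinv g|; elim: m g hT => // m IH g hT gm.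
  have [E|/eqP ne] := eqVneq (unread e g) (Tsup a).
    have -> : g = e by apply: (@unread_perm_inj e); rewrite unread_Tsup.
    exact: connect0.
  have [i [c [d [Tc Td cd ncov]]]] := not_Tsup hT ne.
  have hS : is_SPIT (unread e (perm_comp (sperm i) g)).
    by rewrite unread_sperm; apply/(swap_SPIT hT Tc Td).
  have Dg : i \in Des g by rewrite (Des_interval hT Tc Td).
  have ng : i \notin Des (perm_comp (sperm i) g) by rewrite Des_sperm Dg.
  have := pinv_cover ng; rewrite sperm_compK => /proper_card lt.
  apply: connect_trans (IH _ hS _) _; first lia.
  by apply/connect1/existsP; exists i; rewrite ng sperm_compK eqxx.
(* Up to [Tsource]: each legal swap gains inversions, whose number is bounded by that of pairs of
   positions. *)
have [m] := ubnP (#|{: 'I_(sumn a) * 'I_(sumn a)}| - #|pinv g|).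
elim: m g hT => // m IH g hT gm.
have [E|/eqP ne] := eqVneq (unread e g) (Tsource a).
  have -> : g = perm_comp xi e.
    by apply: (@unread_perm_inj e); rewrite unread_Tsource.
  exact: connect0.
have [i [c [d [Tc Td cd ncov]]]] := not_Tsource hT ne.
have hS : is_SPIT (unread e (perm_comp (sperm i) g)).
  by rewrite unread_sperm; apply/(swap_SPIT hT Tc Td).
have ng : i \notin Des g by rewrite (Des_interval hT Tc Td) -leqNgt.
have lt := proper_card (pinv_cover ng).
have le := max_card (pinv (perm_comp (sperm i) g)).
apply: connect_trans (IH _ hS _); last first.
  rewrite -ltnS; apply: leq_trans gm; rewrite ltnS.
  exact: ltn_sub2l (leq_trans lt le) lt.
by apply/connect1/existsP; exists i; rewrite ng eqxx.
Qed.

End Interval.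

Lemma interval_dp_isomorphic e e' :
  e \in int_R (w_c (Tsup a)) (w_r (Tsup a)) ->
  e' \in int_R (w_c (Tsup a)) (w_r (Tsup a)) ->
  dp_isomorphic (int_L e (perm_comp xi e)) (int_L e' (perm_comp xi e')).
Proof.
move=> eI eI'; pose u := perm_comp e^-1%g e'.
have E g : unread e' (perm_comp g u) = unread e g.
  by apply/ffunP=> b; rewrite !unreadE !perm_compE permKV.
apply: (@dp_isomorphic_mulr _ _ _ u) => [g|g].
  by rewrite !mem_interval // E.
rewrite mem_interval // => /asboolP hT; apply/setP=> i.
have [c Tc] := cell (lo i) hT; have [d Td] := cell (hi i) hT.
by rewrite (Des_interval eI hT Tc Td) (Des_interval eI' (c := c) (d := d)) ?E.
Qed.

(** The permutation [u] that turns the column word into the row word is the same for every tableau;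
    it can be computed on [Tsup]. *)
Lemma RW_dp_isomorphic : dp_isomorphic (RW_c a) (RW_r a).
Proof.
pose u := perm_comp (w_c (Tsup a))^-1%g (w_r (Tsup a)).
have E T : is_SPIT T -> w_r T = perm_comp (w_c T) u.
  move=> hT; apply/permP=> p; rewrite !perm_compE.
  have [b bp] := fill_onto (w_r (Tsup a) p) (SPIT_inj (SPIT_Tsup a)).
  have -> : p = Ordinal (pos_ltn (@row_order a) b).
    apply: (@perm_inj _ (w_r (Tsup a))); rewrite -bp.
    by rewrite readingE //; apply: SPIT_inj (SPIT_Tsup a).
  rewrite !readingE; try exact: SPIT_inj; try exact: SPIT_inj (SPIT_Tsup a).
  rewrite -(readingE (@col_order a) b (SPIT_inj (SPIT_Tsup a))) permK.
  by rewrite readingE //; apply: SPIT_inj.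
apply: (@dp_isomorphic_mulr _ _ _ u) => [g|_ /imsetP[T _ ->]].
  apply/imsetP/imsetP=> -[T _].
    by move=> ->; exists T => //; rewrite E //; apply: asboolW (valP T).
  rewrite E; last exact: asboolW (valP T).
  by move/mulgI=> ->; exists T.
have hT : is_SPIT (val T) := asboolW (valP T).
by rewrite -E // Des_agree.
Qed.

End OneArm.
End Tableaux.

(** * The action on coefficients, and common eigenvectors *)

Section Module.
Import GRing.Theory.
Local Open Scope ring_scope.
Variables (K : fieldType) (a : peak_composition).
Implicit Types (b c d x y : box a) (T U : filling a) (i : 'I_(sumn a).-1).
Implicit Types (v w : Q_space K a) (r : rel (box a)).

(** The action sees [r] only through descents. Equality, rather than isomorphism, follows since the
    proofs of the relations are irrelevant. *)
Lemma eq_Q_module r r' :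
  (forall T, is_SPIT T -> Des (reading r T) = Des (reading r' T)) ->
  Q_module K r = Q_module K r'.
Proof.
move=> H; have E : Q_pi K r = Q_pi K r'.
  apply: functional_extensionality_dep => i; congr linfun.
  apply: functional_extensionality_dep => v; apply: eq_bigr => T _.
  by rewrite /Q_act H //; apply: asboolW (valP T).
rewrite /Q_module; move: (Q_pi_rel _ r) (Q_pi_rel _ r'); rewrite E => h h'.
by rewrite (Prop_irrelevance h h').
Qed.

(** Extended by 0 to all fillings, so that the coefficient at [sact i T] makes sense even when this
    is not a tableau. *)
Definition coef v T : K :=
  if insub T is Some U then v (U : SPIT a) else 0.

Lemma coef_val v (S : SPIT a) : coef v (val S) = v S.
Proof. by rewrite /coef valK. Qed.

Lemma coef_out v T : ~ is_SPIT T -> coef v T = 0.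
Proof. by move=> hT; rewrite /coef insubN //; apply/asboolP. Qed.

Lemma coef_sum (I : finType) (F : I -> Q_space K a) T :
  coef (\sum_j F j) T = \sum_j coef (F j) T.
Proof.
rewrite /coef; case: insub => [U|]; first by rewrite sum_ffunE.
by rewrite big1.
Qed.

Lemma coefZ k v T : coef (k *: v) T = k * coef v T.
Proof. by rewrite /coef; case: insub => [U|]; rewrite ?ffunE ?mulr0. Qed.

Lemma coefN v T : coef (- v) T = - coef v T.
Proof. by rewrite /coef; case: insub => [U|]; rewrite ?ffunE ?oppr0. Qed.

Lemma coef0 T : coef 0 T = 0.
Proof. by rewrite /coef; case: insub => [U|]; rewrite ?ffunE. Qed.

Lemma coef_basis (S : SPIT a) T : coef (basis K S) T = (T == val S)%:R.
Proof.
rewrite /coef; case: insubP => [U _ <-|];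
  first by rewrite ffunE (inj_eq val_inj).
by case: eqP => // ->; rewrite (valP S).
Qed.

Lemma coef_inj v w : (forall T, is_SPIT T -> coef v T = coef w T) -> v = w.
Proof.
move=> H; apply/ffunP=> S; rewrite -!coef_val; apply: H.
exact: asboolW (valP S).
Qed.

Lemma sactK i : involutive (@sact a i).
Proof. by move=> T; apply/ffunP=> b; rewrite !ffunE spermK. Qed.

Lemma reading_sact r i T : injective T ->
  reading r (sact i T) = perm_comp (sperm i) (reading r T).
Proof.
move=> Tinj; apply/permP=> p; rewrite perm_compE.
have [b bp] := fill_onto (reading r T p) Tinj.
have -> : p = Ordinal (pos_ltn r b).
  by apply: (@perm_inj _ (reading r T)); rewrite -bp readingE.
by rewrite !readingE //; [rewrite ffunE | apply: swap_inj].
Qed.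

Lemma Des_sact r i T : injective T ->
  (i \in Des (reading r (sact i T))) = (i \notin Des (reading r T)).
Proof. by move=> Tinj; rewrite reading_sact // Des_sperm. Qed.

(** Only [T] and its swap can contribute to [T]: the former with sign -1 if i is a descent of [T],
    the latter if i is not a descent of the swap, which is the same condition. *)
Lemma coef_Q_pi r i v T : is_SPIT T -> coef (Q_pi K r i v) T =
  if i \in Des (reading r T) then coef v (sact i T) - coef v T else 0.
Proof.
move=> hT; rewrite {1}(basis_sum v) linear_sum coef_sum.
have E (S : SPIT a) : coef (Q_act K r i S) T =
    if i \in Des (reading r T) then
      (sact i T == val S)%:R - (T == val S)%:R else 0.
  have hS : is_SPIT (val S) := asboolW (valP S).
  have DS := Des_sact r i (SPIT_inj hS); have DT := Des_sact r i (SPIT_inj hT).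
  rewrite /Q_act; case: ifP => dS.
    rewrite coefN coef_basis; case: ifP => dT.
      case: (sact i T =P val S) => [E|_]; last by rewrite sub0r.
      by rewrite E dS dT in DT.
    by case: eqP => [E|_]; [rewrite -E dT in dS | rewrite oppr0].
  have -> : (if insub (sact i (val S)) is Some U then basis K U else 0) =
      vec K (sact i (val S)) by [].
  have -> : coef (vec K (sact i (val S))) T = (T == sact i (val S))%:R.
    rewrite /vec; case: insubP => [U _ <-|nS]; first by rewrite coef_basis.
    rewrite coef0; case: eqP => // E; case/negP: nS.
    by rewrite -E; apply/asboolP.
  case: ifP => dT.
    case: (T =P val S) => [E|_]; first by rewrite E dS in dT.
    by rewrite subr0 (can2_eq (sactK i) (sactK i)).
  by case: eqP => // E; rewrite E DS dS in dT.
case: ifP => dT; last first.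
  by apply: big1 => S _; rewrite linearZ /= Q_piE coefZ E dT mulr0.
rewrite {2 3}(basis_sum v) !coef_sum -sumrB; apply: eq_bigr => S _.
by rewrite linearZ /= Q_piE !coefZ E dT !coef_basis mulrBr.
Qed.

Definition common_eigenvector n (M : hecke_module K n) (v : M) : Prop :=
  forall j : 'I_n.-1, hm_pi M j v = - v \/ hm_pi M j v = 0.

Lemma hom_eigenvector n (M N : hecke_module K n) (f : 'Hom(M, N)) (v : M) :
  hecke_hom f -> common_eigenvector v -> common_eigenvector (f v).
Proof.
move=> hf hv i; have := hf i => /lfunP/(_ v); rewrite !comp_lfunE => <-.
by case: (hv i) => ->; rewrite ?linearN ?linear0; [left | right].
Qed.

Lemma sink_eigenvector r (S : SPIT a) :
  (forall i c d, val S c = lo i -> val S d = hi i ->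
     cov c d \/ i \in Des (reading r (val S))) ->
  @common_eigenvector _ (Q_module K r) (basis K S).
Proof.
move=> H i; have hS : is_SPIT (val S) := asboolW (valP S).
have [c Tc] := cell (lo i) hS; have [d Td] := cell (hi i) hS.
rewrite /= Q_piE /Q_act; case: ifP => [_|nd]; first by left.
right; rewrite insubN //; apply/asboolP => /(swap_SPIT hS Tc Td).
by case: (H i c d Tc Td) => [-> //|]; rewrite nd.
Qed.

(** At the first value m where they differ, [Tsource] has m in [b] and [T] has it in [d]. Then [b]
    is an arm box and [d] lies in a higher row. The left neighbour of [b] holds the preceding value
    in both, giving a descent of [T] that [Tsource] lacks. *)
Lemma Tsource_Des_subset T : is_SPIT T ->
  Des (w_r T) \subset Des (w_r (Tsource a)) -> T = Tsource a.
Proof.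
move=> hT /subsetP sub; have hS := SPIT_Tsource a.
suff H m b : Tsource a b = m :> nat -> T b = m :> nat.
  by apply/ffunP=> b; apply/val_inj/H.
elim/ltn_ind: m b => m IH b bm.
have [d dm] := fill_onto (Tsource a b) (SPIT_inj hT).
have {}dm : T d = m :> nat by rewrite dm.
have [->//|ne] := eqVneq b d; exfalso.
have low x : (Tsource a x < m)%N -> T x = Tsource a x.
  by move=> xm; apply/val_inj; apply: IH xm _ _.
have Sd : (m < Tsource a d)%N.
  case: ltngtP => // [lt|E]; first by move: (lt); rewrite -(low _ lt) dm ltnn.
  by case/eqP: ne; apply/(SPIT_inj hS)/val_inj; rewrite /= bm.
have Tb : (m < T b)%N.
  case: ltngtP => // [lt|E]; last first.
    by case/eqP: ne; apply/(SPIT_inj hT)/val_inj; rewrite /= dm.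
  have [x xb] := fill_onto (T b) (SPIT_inj hS).
  have E : T x = T b by rewrite low ?xb.
  by move: lt; rewrite -xb (SPIT_inj hT E) bm ltnn.
have bd : (T d < T b)%N by rewrite dm.
have ncov := SPIT_ncov hT bd.
have Sbd : (Tsource a b < Tsource a d)%N by rewrite bm.
have nrow : ~~ (row d < row b)%N.
  by apply/negP=> /Tsource_row; rewrite bm; lia.
have ncol : row b = row d -> (col b < col d)%N.
  move=> rbd; case: ltngtP => // [/(Tsource_col (esym rbd))|cbd]; first by lia.
  by case/eqP: ne; apply: box_eq.
have [rbd b2] : (row b < row d)%N /\ (1 < col b)%N.
  by move: ncov; rewrite /cov; lia.
have [b' [rb' cb']] := ex_box_left (leq_pred (col b)).
have Sb' : Tsource a b' = m.-1 :> nat.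
  by move: bm; rewrite !Tsource_val rb' cb'; lia.
have m0 : (0 < m)%N by move: bm; rewrite Tsource_val; lia.
have hm : (m.-1 < (sumn a).-1)%N by have := ltn_ord (T d); lia.
pose i : 'I_(sumn a).-1 := Ordinal hm.
have /(_ i) := sub; rewrite (Des_row_order hS (c := b') (d := b)).
- rewrite rb' ltnn; have Tb' : T b' = lo i.
    by apply: val_inj; rewrite /= (IH m.-1) //; lia.
  have Td : T d = hi i by apply: val_inj; rewrite /= dm; lia.
  by rewrite (Des_row_order hT Tb' Td) rb' rbd => /(_ isT).
- by apply: val_inj; rewrite /= Sb'.
- by apply: val_inj; rewrite /= bm; lia.
Qed.

(* The support is closed under going up, so it contains Tsource and the       *)
(* indices D of the nonzero eigenvalues are descents of Tsource. It is also   *)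
(* closed under going down along a descent outside D, so the descents of its  *)
(* lowest elements are in D; these elements are then equal to Tsource.        *)
Lemma row_eigenvector v T : @common_eigenvector _ (Q_r K a) v ->
  coef v T != 0 -> T = Tsource a.
Proof.
move=> hv.
pose D i := Q_pi K (@row_order a) i v != 0.
have SP U : coef v U != 0 -> is_SPIT U.
  by apply: contra_neqP => /coef_out.
have DD U i : coef v U != 0 -> D i -> i \in Des (w_r U).
  move=> vU Di; have hU := SP _ vU; have := coef_Q_pi (@row_order a) i v hU.
  case: (hv i) => /= E; last by rewrite /D E eqxx in Di.
  rewrite E coefN; case: ifP => // _ /eqP; rewrite oppr_eq0.
  by rewrite (negPf vU).
have ND U i : is_SPIT U -> ~~ D i -> i \in Des (w_r U) ->
    coef v (sact i U) = coef v U.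
  move=> hU /negPn/eqP E dU; have := coef_Q_pi (@row_order a) i v hU.
  by rewrite E dU coef0 => /esym/eqP; rewrite subr_eq0 => /eqP.
have up U : coef v U != 0 -> coef v (Tsource a) != 0 /\
    (#|pinv (w_r U)| <= #|pinv (w_r (Tsource a))| ?= iff (U == Tsource a))%N.
  have [m] := ubnP (#|{: 'I_(sumn a) * 'I_(sumn a)}| - #|pinv (w_r U)|)%N.
  elim: m U => // m IH U Um vU.
  have [E|ne] := eqVneq U (Tsource a).
    by move: vU; rewrite E => ?; split=> //; apply/leqif_refl.
  have hU := SP _ vU.
  have [i [c [d [Tc Td cd ncov]]]] := not_Tsource hU (elimN eqP ne).
  have hS : is_SPIT (sact i U) by apply/(swap_SPIT hU Tc Td).
  have ni : i \notin Des (w_r U) by rewrite (Des_row_order hU Tc Td) -leqNgt.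
  have nD : ~~ D i by apply: contra ni; exact: DD.
  have dS : i \in Des (w_r (sact i U)) by rewrite Des_sact //; apply: SPIT_inj.
  have vS : coef v (sact i U) != 0 by rewrite -(ND _ _ hS nD dS) sactK.
  have lt := proper_card (pinv_cover ni).
  rewrite -reading_sact in lt; last exact: SPIT_inj.
  have le := max_card (pinv (w_r (sact i U))).
  have [|vs [le_s _]] := IH _ _ vS.
    rewrite -ltnS; apply: leq_trans Um; rewrite ltnS.
    exact: ltn_sub2l (leq_trans lt le) lt.
  split=> //; split; first exact: leq_trans (ltnW lt) le_s.
  by apply/negbTE; rewrite neq_ltn (leq_trans lt le_s).
have low U : coef v U != 0 -> (#|pinv (w_r (Tsource a))| <= #|pinv (w_r U)|)%N.
  have [m] := ubnP #|pinv (w_r U)|; elim: m U => // m IH U Um vU.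
  have hU := SP _ vU.
  have [sub|/subsetPn[i dU nd]] :=
    boolP (Des (w_r U) \subset Des (w_r (Tsource a))).
    by rewrite (Tsource_Des_subset hU sub).
  have nD : ~~ D i by apply: contra nd; apply: DD; exact: (up _ vU).1.
  have vS : coef v (sact i U) != 0 by rewrite ND.
  have ni : i \notin Des (w_r (sact i U)).
    by rewrite Des_sact ?dU //; apply: SPIT_inj.
  have := proper_card (pinv_cover ni); rewrite -reading_sact ?sactK; last first.
    exact/SPIT_inj/SP.
  move=> lt; apply: leq_trans (ltnW lt); apply: IH vS.
  by apply: leq_trans lt _.
move=> vT; have [_ [le eq]] := up _ vT.
by apply/eqP; rewrite -eq eqn_leq le low.
Qed.

End Module.

(** * Two arms: a second one-dimensional submodule of [Q_c] *)

Lemma Tsource_sink (a : peak_composition) (i : 'I_(sumn a).-1) (c d : box a) :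
  Tsource a c = lo i -> Tsource a d = hi i ->
  cov c d \/ i \in Des (w_c (Tsource a)).
Proof.
move=> Tc Td; have hS := SPIT_Tsource a.
case: (boolP (cov c d)) => ncd; [by left | right].
rewrite (DesE _ (SPIT_inj hS) Tc Td) pos_col_lt.
have cd : Tsource a c < Tsource a d by rewrite Tc Td /=.
have ne : c != d by apply/eqP=> E; move: cd; rewrite E ltnn.
have rcd : row c < row d.
  case: ltngtP => // [/Tsource_row|rcd]; first by lia.
  case: (ltngtP (col c) (col d)) => [ccd|/(Tsource_col (esym rcd))|ccd];
    try lia.
    by move: ncd; rewrite /cov rcd eqxx ccd.
  by move: cd; rewrite (box_eq rcd ccd) ltnn.
have [c1|c2] := leqP (col c) 1.
  by have [-> ->] := adjacent_up hS Tc Td rcd c1.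
have [d0 [rd0 cd0]] := ex_box_left (leq0n (col d)).
have cd0' : Tsource a c < Tsource a d0 by apply: Tsource_row; rewrite rd0.
have : Tsource a d = (Tsource a c).+1 :> nat by rewrite Tc Td.
by move: cd0'; rewrite !Tsource_val rd0 cd0; lia.
Qed.

Section NotIsomorphic.
Import GRing.Theory.
Variables (K : fieldType) (a : peak_composition).
Implicit Types (b c d x y : box a) (T U : filling a) (i : 'I_(sumn a).-1).
Variables (r1 r2 : nat).
Hypotheses (r12 : r1 < r2) (r2a : r2 < size a).
Hypotheses (arm1 : 2 < nth 0 a r1) (arm2 : 2 < nth 0 a r2).

(* Row by row, but with the arm of row r1 placed right after row r2; the      *)
(* factor (sumn a).*2 makes the row index dominate.                           *)
Definition star_key b : nat :=
  if (row b == r1) && (1 < col b) then r2 * (sumn a).*2 + sumn a + col b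
  else row b * (sumn a).*2 + col b.

Definition Tstar : filling a := rank_fill star_key.

Lemma col_lt b : col b < sumn a.
Proof.
apply: leq_trans (ltn_col b) _; rewrite sumnE (big_nth 0) big_mkord.
by rewrite (bigD1 (tag b)) //=; apply: leq_addr.
Qed.

Lemma star_key_lt x y : (star_key x < star_key y) =
  let rx := if (row x == r1) && (1 < col x) then r2 else row x in
  let ry := if (row y == r1) && (1 < col y) then r2 else row y in
  let cx := if (row x == r1) && (1 < col x) then sumn a + col x else col x in
  let cy := if (row y == r1) && (1 < col y) then sumn a + col y else col y in
  (rx < ry) || ((rx == ry) && (cx < cy)).
Proof.
have := col_lt x; have := col_lt y; rewrite /star_key.
by case: ifP; case: ifP => _ _ /=; nia.
Qed.

Lemma star_key_inj : injective star_key.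
Proof.
move=> x y E; have := star_key_lt x y; have := star_key_lt y x.
have := col_lt x; have := col_lt y.
rewrite E ltnn /= => ? ?; case: ifP; case: ifP => ? ? ? ?; apply: box_eq; lia.
Qed.

Lemma SPIT_Tstar : is_SPIT Tstar.
Proof.
apply/SPITP; split=> [|x y]; first exact/rank_fill_inj/star_key_inj.
rewrite rank_fill_mono; last exact: star_key_inj.
rewrite star_key_lt /cov /=; have := col_lt x.
by case: ifP; case: ifP; lia.
Qed.

(** The new transition goes from the end of row [r2] to the third box of row [r1]. Row [r2] also
    reaches the third column and [r1 < r2], so column reading meets the latter box first: a
    descent. *)
Lemma Tstar_sink i c d : Tstar c = lo i -> Tstar d = hi i ->
  cov c d \/ i \in Des (w_c Tstar).
Proof.
move=> Tc Td; have hT := SPIT_Tstar.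
case: (boolP (cov c d)) => ncd; [by left | right].
rewrite (DesE _ (SPIT_inj hT) Tc Td) pos_col_lt.
have cd : star_key c < star_key d.
  by rewrite -(rank_fill_mono _ _ star_key_inj) Tc Td /=.
have between x : ~~ ((star_key c < star_key x) && (star_key x < star_key d)).
  rewrite -!(rank_fill_mono _ _ star_key_inj) -/Tstar Tc Td /=; lia.
have [d0 [rd0 cd0]] := ex_box_left (leq0n (col d)).
have [d1 [rd1 cd1]] := ex_box_left (leq_pred (col d)).
(* When [d] starts the postponed arm, its left neighbour [d1] is not its predecessor; that [z2] is
   not strictly between forces [c] into the arm of row [r2]. *)
have [z0 [rz0 cz0]] := ex_box r2a (ltn_trans (isT : 0 < 2) arm2).
have [z2 [rz2 cz2]] := ex_box r2a arm2.
move: (between d0) (between d1) (between z0) (between z2) cd ncd.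
rewrite !star_key_lt /cov /= rd0 cd0 rd1 cd1 rz0 cz0 rz2 cz2.
have -> : (r2 == r1) = false by lia.
rewrite !andbF !andFb /=; have := col_lt c; have := col_lt d.
by case: (boolP (_ && (1 < col c))); case: (boolP (_ && (1 < col d)));
  case: (boolP (_ && (1 < (col d).-1))) => /= ? ? ?; lia.
Qed.

Lemma Tstar_neq : Tstar <> Tsource a.
Proof.
have r1a := ltn_trans r12 r2a.
have [x [rx cx]] := ex_box r1a arm1.
have [y [ry cy]] := ex_box r2a (ltn_trans (isT : 0 < 2) arm2).
move=> E; have : Tsource a x < Tsource a y by apply: Tsource_row; rewrite rx ry.
rewrite -E rank_fill_mono; last exact: star_key_inj.
rewrite star_key_lt rx cx ry cy /= eqxx; have -> : (r2 == r1) = false by lia.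
by rewrite andFb ltnn eqxx.
Qed.

Local Open Scope ring_scope.

(** A homomorphism maps common eigenvectors to common eigenvectors, so those of [Tsource] and
    [Tstar] both land on the line of [Tsource], against injectivity. *)
Lemma Q_not_iso : ~ hecke_iso (Q_c K a) (Q_r K a).
Proof.
case=> f hf fbij.
have hS := SPIT_Tsource a.
pose S : SPIT a := Sub (Tsource a) (introT (asboolP _) hS).
pose S' : SPIT a := Sub Tstar (introT (asboolP _) SPIT_Tstar).
have SS' : S' != S by rewrite -(inj_eq val_inj) /=; apply/eqP/Tstar_neq.
have line (U : SPIT a) : @common_eigenvector K _ (Q_c K a) (basis K U) ->
    exists k, f (basis K U) = k *: basis K S.
  move/(hom_eigenvector hf)/row_eigenvector => H.
  exists (coef (f (basis K U)) (val S)); apply: coef_inj => T hT.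
  rewrite coefZ coef_basis; case: eqP => [->|ne]; first by rewrite mulr1.
  by rewrite mulr0; apply/eqP/negPn/negP=> /H.
have [|k Ek] := line S.
  apply: sink_eigenvector => i c d Tc Td.
  exact: Tsource_sink.
have [|k' Ek'] := line S'.
  by apply: sink_eigenvector => i c d; apply: Tstar_sink.
have k0 : k != 0.
  apply/eqP=> k0; have := bij_inj fbij; move/(_ (basis K S) 0).
  rewrite Ek k0 scale0r linear0 => /(_ erefl).
  move/(congr1 (fun v => coef v (val S))).
  by rewrite coef_basis eqxx coef0 => /eqP; rewrite oner_eq0.
have : f (k *: basis K S') = f (k' *: basis K S).
  by rewrite !linearZ /= Ek Ek' !scalerA mulrC.
move/(bij_inj fbij)/(congr1 (fun v => coef v (val S'))).
rewrite !coefZ !coef_basis eqxx (inj_eq val_inj) (negPf SS') mulr1 mulr0.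
by move/eqP; rewrite (negPf k0).
Qed.

End NotIsomorphic.

(** * Equidistribution of descent sets *)

Lemma ltn_lex (n B C u v : nat) : u < n -> v < n ->
  (B * n + u < C * n + v) = (B < C) || ((B == C) && (u < v)).
Proof. by nia. Qed.

Section Equidistribution.
Variable a : peak_composition.
Implicit Types (b c d x y : box a) (T U : filling a) (i : 'I_(sumn a).-1).
Implicit Types (D E : {set 'I_(sumn a).-1}) (p q : rel (box a)).

(* The index of the block of v when the numbers are cut after each element    *)
(* of D.                                                                      *)
Definition block D (v : nat) : nat := #|[set i in D | i < v]|.

Lemma block_mono D v w : v <= w -> block D v <= block D w.
Proof.
move=> vw; apply/subset_leq_card/subsetP=> i; rewrite !inE => /andP[-> /=].
by move/leq_trans; apply.
Qed.

Lemma block_lt D v w : block D v < block D w -> v < w.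
Proof.
by rewrite ltnNge => vw; rewrite ltnNge; apply: contra vw => /block_mono.
Qed.

Lemma block_lo_hi D i : block D (hi i) = (i \in D) + block D (lo i).
Proof.
rewrite /block (cardsD1 i) !inE /= ltnSn andbT; congr (_ + _).
by apply: eq_card => j; rewrite !inE -(inj_eq val_inj) /=; lia.
Qed.

Definition block_key D p T b : nat := block D (T b) * sumn a + pos p b.

Lemma block_key_lt D p T x y : (block_key D p T x < block_key D p T y) =
  (block D (T x) < block D (T y)) ||
  ((block D (T x) == block D (T y)) && (pos p x < pos p y)).
Proof.
by rewrite /block_key ltn_lex ?pos_ltn.
Qed.

Lemma block_key_inj D p T : injective (block_key D p T).
Proof.
move=> x y E; have := block_key_lt D p T x y; have := block_key_lt D p T y x.
by rewrite E ltnn => ? ?; apply: (@pos_inj _ p); lia.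
Qed.

(** Passing from i to i+1 either enters a new block, when i is in D, or stays in the block, where
    not being a descent means moving forward in [p]. *)
Lemma Des_subset D p T : injective T ->
  reflect (forall x y, T x < T y -> block_key D p T x < block_key D p T y)
    (Des (reading p T) \subset D).
Proof.
move=> Tinj; apply: (iffP subsetP) => [sub x y|mono i].
  apply: (adjacent_mono Tinj) => i c d Tc Td.
  rewrite block_key_lt Tc Td block_lo_hi.
  case: (boolP (i \in D)) => iD /=; first by rewrite add1n ltnSn.
  rewrite add0n eqxx ltnn /= ltn_neqAle leqNgt (inj_eq (@pos_inj _ _)).
  rewrite -(DesE p Tinj Tc Td) (contra (sub i) iD) andbT.
  by apply: contraNneq (lo_hi i) => cd; rewrite -Tc -Td cd.
have [c Tc] := fill_onto (lo i) Tinj; have [d Td] := fill_onto (hi i) Tinj.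
rewrite (DesE p Tinj Tc Td) => dc; apply/negPn/negP=> iD.
have /mono : T c < T d by rewrite Tc Td /=.
by rewrite block_key_lt Tc Td block_lo_hi (negPf iD); lia.
Qed.

(* Same blocks as T, with each block read increasingly by q.                  *)
Definition resort D q T : filling a := rank_fill (block_key D q T).

Lemma resort_inj D q T : injective (resort D q T).
Proof. exact/rank_fill_inj/block_key_inj. Qed.

Lemma resort_mono D q T x y : (resort D q T x < resort D q T y) =
  (block_key D q T x < block_key D q T y).
Proof. exact/rank_fill_mono/block_key_inj. Qed.

(** Re-sorting permutes boxes only inside blocks. If [z] is the box where [T] has the new entry of
    [b], equally many boxes precede [z] in [T] and [b] in the key; different blocks would make one
    of these sets strictly contain the other. *)
Lemma block_resort D q T b : injective T ->
  block D (resort D q T b) = block D (T b).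
Proof.
move=> Tinj; have [z zb] := fill_onto (resort D q T b) Tinj.
have zv : #|[set y | T y < T z]| =
  #|[set y | block_key D q T y < block_key D q T b]|.
  by rewrite -fill_rank // zb /resort rank_fillE.
rewrite -zb; case: (ltngtP (block D (T z)) (block D (T b))) => // lt; exfalso.
  suff : #|[set y | T y < T z]| <
      #|[set y | block_key D q T y < block_key D q T b]|.
    by rewrite zv ltnn.
  apply: proper_card; apply/properP; split; last first.
    by exists z; rewrite !inE ?ltnn // block_key_lt lt.
  apply/subsetP=> y; rewrite !inE block_key_lt => /ltnW/(block_mono D).
  by move/leq_ltn_trans/(_ lt) => ->.
suff : #|[set y | block_key D q T y < block_key D q T b]| <
    #|[set y | T y < T z]|.
  by rewrite zv ltnn.
apply: proper_card; apply/properP; split; last first.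
  by exists b; rewrite !inE ?ltnn // (block_lt lt).
apply/subsetP=> y; rewrite !inE block_key_lt => yb.
by apply: (@block_lt D); apply: leq_ltn_trans lt; lia.
Qed.

Lemma block_key_resort D p q T b : injective T ->
  block_key D p (resort D q T) b = block_key D p T b.
Proof. by move=> Tinj; rewrite /block_key block_resort. Qed.

Lemma Des_resort D q T : injective T ->
  Des (reading q (resort D q T)) \subset D.
Proof.
move=> Tinj; apply/Des_subset => [|x y]; first exact: resort_inj.
by rewrite resort_mono !block_key_resort.
Qed.

Lemma resort_cancel D p T U : injective T -> injective U ->
  Des (reading p T) \subset D -> Des (reading p U) \subset D ->
  (forall b, block D (T b) = block D (U b)) -> T = U.
Proof.
move=> Tinj Uinj /(Des_subset _ _ Tinj) Tm /(Des_subset _ _ Uinj) Um TU.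
apply: eq_fill => // x y /Tm; rewrite /block_key !TU => lt.
case: (ltngtP (U x) (U y)) => // [/Um|/val_inj/Uinj E].
  by rewrite /block_key; lia.
by move: lt; rewrite E ltnn.
Qed.

(* How both reading orders decide the covers of cov.                          *)
Definition compatible p : Prop :=
  (forall x y, row x = row y -> col x < col y -> pos p x < pos p y) /\
  (forall x y, row y = (row x).+1 -> col x = 1 -> col y = 0 ->
     pos p y < pos p x).

Lemma compatible_col : compatible (@col_order a).
Proof. by split=> x y; rewrite pos_col_lt; lia. Qed.

Lemma compatible_row : compatible (@row_order a).
Proof. by split=> x y; rewrite pos_row_lt; lia. Qed.

(** A relation of [cov] between different rows passes through the second box of one row and the
    first box of the next. Since [p] reads these backwards, they lie in different blocks. So only
    relations within a row occur inside a block, and [q] respects them. *)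
Lemma SPIT_resort D p q T : compatible p -> compatible q -> is_SPIT T ->
  Des (reading p T) \subset D -> is_SPIT (resort D q T).
Proof.
move=> [_ p2] [q1 _] hT sub; have Tinj := SPIT_inj hT.
have /(Des_subset _ _ Tinj) mono := sub.
apply/SPITP; split=> [|x y xy]; first exact: resort_inj.
rewrite resort_mono block_key_lt; have Txy := SPIT_cov hT xy.
case: ltngtP (block_mono D (ltnW Txy)) => //= E _.
move: xy; rewrite /cov => /orP[/andP[/eqP rxy cxy]|/andP[rxy cx]].
  exact: q1.
exfalso; have [x1 [rx1 cx1]] := ex_box_below rxy (leqnn 1).
have [y0 [ry0 cy0]] : exists y0 : box a, row y0 = (row x).+1 /\ col y0 = 0.
  case: (ltngtP (row x).+1 (row y)) => [lt||eq]; last 2 first.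
  - lia.
  - by have [y0 [r0 c0]] := ex_box_left (leq0n (col y)); exists y0; rewrite r0.
  exact: ex_box_below lt _.
have le_x : T x <= T x1.
  have [->//|ne] := eqVneq x x1; apply/ltnW/(SPIT_cov hT).
  by move: (box_neq ne); rewrite /cov; lia.
have le_y : T y0 <= T y.
  have [->//|ne] := eqVneq y y0; apply/ltnW/(SPIT_cov hT).
  by move: (box_neq ne); rewrite /cov; lia.
have lt_m : T x1 < T y0 by apply: (SPIT_cov hT); rewrite /cov; lia.
have := mono _ _ lt_m; rewrite block_key_lt; have := p2 x1 y0.
rewrite rx1 ry0 => /(_ erefl cx1 cy0).
have := block_mono D le_x; have := block_mono D le_y.
have := block_mono D (ltnW lt_m); lia.
Qed.

Lemma card_Des_subset_le D p q : compatible p -> compatible q ->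
  #|[set T : SPIT a | Des (reading p (val T)) \subset D]| <=
  #|[set T : SPIT a | Des (reading q (val T)) \subset D]|.
Proof.
(* The default [T] of [insubd] is never taken on the set being counted, by [fE]. *)
move=> hp hq; pose f (T : SPIT a) : SPIT a := insubd T (resort D q (val T)).
have hS (T : SPIT a) : is_SPIT (val T) := asboolW (valP T).
have fE (T : SPIT a) : Des (reading p (val T)) \subset D ->
    val (f T) = resort D q (val T).
  by move=> sub; rewrite val_insubd asboolT //; apply: SPIT_resort sub.
rewrite -(card_in_imset (f := f)) => [|T U]; last first.
  rewrite !inE => hT hU /(congr1 val); rewrite !fE // => E; apply: val_inj.
  apply: (resort_cancel _ _ hT hU) => [||b]; try exact: SPIT_inj.
  by rewrite -(block_resort D q b (SPIT_inj (hS T))) E block_resort //;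
    apply: SPIT_inj.
apply/subset_leq_card/subsetP=> _ /imsetP[T + ->]; rewrite !inE => hT.
by rewrite fE // Des_resort //; apply: SPIT_inj.
Qed.

(** Counts for descent sets contained in D are sums over the subsets of D; strong induction on the
    size of D cancels the proper ones. *)
Lemma card_Des_eq D p q : compatible p -> compatible q ->
  #|[set T : SPIT a | Des (reading p (val T)) == D]| =
  #|[set T : SPIT a | Des (reading q (val T)) == D]|.
Proof.
move=> hp hq.
have sumE r E : #|[set T : SPIT a | Des (reading r (val T)) \subset E]| =
    \sum_(F : {set 'I_(sumn a).-1} | F \subset E)
      #|[set T : SPIT a | Des (reading r (val T)) == F]|.
  rewrite -sum1_card; under eq_bigl do rewrite inE.
  rewrite (partition_big (fun T : SPIT a => Des (reading r (val T)))
    (fun F => F \subset E)) //=.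
  apply: eq_bigr => F FE; rewrite -sum1_card; apply: eq_bigl => T.
  by rewrite inE; case: eqP => [->|]; rewrite ?FE ?andbF.
have [m] := ubnP #|D|; elim: m D => // m IH D Dm.
have : #|[set T : SPIT a | Des (reading p (val T)) \subset D]| =
    #|[set T : SPIT a | Des (reading q (val T)) \subset D]|.
  by apply/eqP; rewrite eqn_leq !card_Des_subset_le.
rewrite !sumE (bigD1 D) //= [RHS](bigD1 D) //=.
rewrite [X in _ + X = _](_ : _ =
  \sum_(F : {set 'I_(sumn a).-1} | (F \subset D) && (F != D))
  #|[set T : SPIT a | Des (reading q (val T)) == F]|); first by move/addIn.
apply: eq_bigr => F /andP[FD neFD]; apply: IH; rewrite -ltnS.
by apply: leq_trans Dm; rewrite ltnS; apply: proper_card;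
  rewrite properEneq neFD FD.
Qed.

End Equidistribution.

(** * The characteristic as a sum over tableaux *)

Section Characteristic.
Import GRing.Theory.
Local Open Scope ring_scope.

(** Built one unit at a time: a new unit opens a part 1 after a cut and otherwise enlarges the last
    part. This indexes one-dimensional quotients by compositions, as [is_ch] requires. *)
Lemma ex_composition n (D : {set 'I_n.-1}) :
  exists b, [/\ is_composition b, sumn b = n & cset n b = D].
Proof.
pose P (p : pred nat) m := exists b,
  [/\ is_composition b, sumn b = m.+1, b != [::] &
  forall i, (i < m)%N -> (i.+1 \in partial_sums b) = p i].
have psum c (x : nat) : partial_sums (rcons c x) =
  [seq sumn (take j c) | j <- iota 1 (size c)].
  rewrite /partial_sums size_rcons; apply/eq_in_map => j;
    rewrite mem_iota => jc.
  by rewrite -cats1 takel_cat //; lia.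
have ne c (x : nat) : rcons c x != [::] by case: c.
have ex p m : P p m.
  elim: m => [|m [b [bc bs]]]; first by exists [:: 1%N].
  case: (lastP b) bc bs => // c x;
    rewrite /is_composition all_rcons => /andP[x0 c0].
  rewrite sumn_rcons /= in x0 * => cx _ H; rewrite psum in H.
  case pm : (p m).
    exists (rcons (rcons c x) 1); split;
      rewrite /is_composition ?all_rcons /= ?x0 ?sumn_rcons ?ne //; try lia.
    move=> i im; rewrite psum size_rcons -(addn1 (size c)) iotaD.
    rewrite map_cat mem_cat.
    have -> : [seq sumn (take j (rcons c x)) | j <- iota 1 (size c)] =
        [seq sumn (take j c) | j <- iota 1 (size c)].
      apply/eq_in_map => j; rewrite mem_iota => jc.
      by rewrite -cats1 takel_cat //; lia.
    rewrite /= inE take_oversize ?size_rcons ?sumn_rcons; last lia.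
    have [{}im|mi] := ltnP i m; first by rewrite H //; case: eqP => [|_];
      rewrite ?orbF //; lia.
    have -> : i = m by lia.
    by rewrite cx eqxx orbT.
  exists (rcons c x.+1); split;
    rewrite /is_composition ?all_rcons /= ?sumn_rcons ?ne //; try lia.
  move=> i im; rewrite psum; have [{}im|mi] := ltnP i m; first exact: H.
  have -> : i = m by lia.
  rewrite pm; apply/mapP => -[j _ E].
  have : (sumn (take j c) <= sumn c)%N.
    by rewrite -{2}(cat_take_drop j c) sumn_cat leq_addr.
  lia.
case: n D => [|n] D.
  exists [::]; split=> //; apply/setP=> -[]; by [].
have [b [bc bs _ H]] :=
  ex (fun i => [exists j : 'I_n, (j == i :> nat) && (j \in D)]) n.
exists b; split=> //; apply/setP=> i; rewrite inE H //.
apply/existsP/idP=> [[j /andP[/eqP/val_inj <-]]|iD] //.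
by exists i; rewrite eqxx.
Qed.

Lemma ex_lfun (K : fieldType) (V W : vectType K) (f : V -> W) :
  linear f -> exists g : 'Hom(V, W), forall v, g v = f v.
Proof.
move=> fl; pose L := GRing.isLinear.Build _ _ _ _ _ fl.
pose f' : {linear V -> W} := HB.pack f L.
by exists (linfun f') => v; rewrite (lfunE f').
Qed.

Section Submodule.
Variables (K : fieldType) (n : nat) (M : hecke_module K n) (W : {vspace M}).
Definition stable := forall i v, v \in W -> hm_pi M i v \in W.

Definition sub_incl : 'Hom(subvs_of W, M) := linfun vsval.
Definition sub_pi i : 'End(subvs_of W) :=
  linfun (vsproj W \o hm_pi M i \o vsval).

Lemma sub_inclE u : sub_incl u = vsval u.
Proof. by rewrite lfunE. Qed.

Hypothesis stabW : stable.

Lemma sub_piE i u : vsval (sub_pi i u) = hm_pi M i (vsval u).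
Proof.
by rewrite lfunE /= vsprojK // stabW ?subvsP.
Qed.

Lemma sub_rel : hecke_relations sub_pi.
Proof.
case: (hm_rel M) => r1 r2 r3.
split=> [i|i j ij|i j ij]; apply/lfunP=> u; apply: subvs_inj.
- rewrite comp_lfunE !sub_piE -comp_lfunE r1 !opp_lfunE /=.
  by rewrite sub_piE.
- have /lfunP/(_ (vsval u)) := r2 i j ij.
  by rewrite !comp_lfunE !sub_piE.
- have /lfunP/(_ (vsval u)) := r3 i j ij.
  by rewrite !comp_lfunE !sub_piE.
Qed.

Definition submodule : hecke_module K n := HeckeModule sub_rel.

End Submodule.

Section ChExact.
Variables (K : fieldType) (n : nat).
Implicit Types (M N P : hecke_module K n).

Lemma ch_exact M N P (f : 'Hom(M, N)) (g : 'Hom(N, P)) :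
  short_exact f g -> ch N = fun m => ch M m + ch P m.
Proof. by case: (chP K n) => H _; apply: H. Qed.

Lemma ch_zero M : (forall v : M, v = 0) -> ch M = fun=> 0.
Proof.
(* For the zero module, zero maps [0 -> M -> M -> M -> 0] form an exact sequence, whence
   [ch M = ch M + ch M]. *)
move=> M0; have E : short_exact (0 : 'End(M)) (0 : 'End(M)).
  have all0 (U V : {vspace M}) : U = V.
    apply/eqP; rewrite eqEsubv; apply/andP; split; apply/subvP => v _;
    by rewrite (M0 v) mem0v.
  split; try exact: all0; by move=> i; rewrite comp_lfun0l comp_lfun0r.
have := ch_exact E => H; apply: functional_extensionality_dep => m.
have := congr1 (fun F => F m) H => /= /eqP.
by rewrite -{1}[ch M m]addr0 eq_sym (inj_eq (addrI _)) => /eqP.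
Qed.

Variable M : hecke_module K n.

Lemma ch_sub0 (H : stable (0%VS : {vspace M})) : ch (submodule H) = fun=> 0.
Proof.
apply: ch_zero => v; apply: subvs_inj; rewrite linear0.
by apply/eqP; rewrite -memv0; apply: subvsP.
Qed.

Lemma ch_full (H : stable (fullv : {vspace M})) : ch M = ch (submodule H).
Proof.
have H0 : stable (0%VS : {vspace M}).
  by move=> i v; rewrite memv0 => /eqP->; rewrite linear0 mem0v.
have E : @short_exact K n (submodule H) M (submodule H0) (sub_incl fullv) 0.
  split.
  - by move=> i; apply/lfunP=> u; rewrite !comp_lfunE !sub_inclE sub_piE.
  - by move=> i; rewrite comp_lfun0l comp_lfun0r.
  - apply/eqP/lker0P => u v; rewrite !sub_inclE; exact: subvs_inj.
  - have -> : lker (0 : 'Hom(M, subvs_of (0%VS : {vspace M}))) = fullv.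
      by apply/vspaceP=> v; rewrite memv_ker lfunE memvf eqxx.
    apply/vspaceP=> v; rewrite memvf; apply/memv_imgP.
    by exists (vsproj fullv v); rewrite ?memvf // sub_inclE vsprojK ?memvf.
  - apply/vspaceP=> v; rewrite memvf (_ : v = 0) ?mem0v //.
    apply: subvs_inj; rewrite linear0.
    by apply/eqP; rewrite -memv0; apply: subvsP.
rewrite (ch_exact E) ch_sub0; apply: functional_extensionality_dep => m.
by rewrite addr0.
Qed.

(** The functional [g] identifies the quotient of [W'] by [W] with the irreducible module of descent
    set [D]; the vector [e] makes it surjective. *)
Lemma ch_step (W W' : {vspace M}) (H : stable W) (H' : stable W')
    (D : {set 'I_n.-1}) (g : 'Hom(M, K^o)) (e : M) :
  (W <= W')%VS -> {in W', forall v, (v \in W) = (g v == 0)} ->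
  e \in W' -> g e = 1 ->
  {in W', forall v i, g (hm_pi M i v) = (if i \in D then -1 else 0) *: g v} ->
  ch (submodule H') = fun m => ch (submodule H) m + fundamental K D m.
Proof.
move=> sWW' kerg eW' ge gpi; have [b [bc bs bD]] := ex_composition D.
pose f : 'Hom(submodule H, submodule H') := linfun (vsproj W' \o vsval).
pose h : 'Hom(submodule H', irr_module K n b) := linfun (g \o vsval).
have fE u : vsval (f u : subvs_of W') = vsval (u : subvs_of W).
  rewrite lfunE /= vsprojK //.
  exact: (subvP sWW') (subvsP _).
have hE u : h u = g (vsval (u : subvs_of W')) by rewrite lfunE.
have fh : short_exact f h.
  split.
  - by move=> i; apply/lfunP=> u; apply: subvs_inj;
      rewrite !comp_lfunE sub_piE // !fE sub_piE.
  - move=> i; apply/lfunP=> u; rewrite !comp_lfunE hE sub_piE // gpi ?subvsP //.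
    by rewrite /= /irr_pi scale_lfunE id_lfunE hE bD.
  - by apply/eqP/lker0P => u v uv; apply: subvs_inj; rewrite -!fE uv.
  - apply/vspaceP=> u; rewrite memv_ker hE -kerg ?subvsP //.
    apply/memv_imgP/idP=> [[v _ ->]|uW]; first by rewrite fE subvsP.
    exists (vsproj W (vsval u)); first exact: memvf.
    by apply: subvs_inj; rewrite fE vsprojK.
  - apply/vspaceP=> x; rewrite memvf; apply/memv_imgP.
    exists (x *: (vsproj W' e : submodule H')); first exact: memvf.
    by rewrite linearZ /= hE vsprojK // ge [RHS]mulr1.
rewrite (ch_exact fh); apply: functional_extensionality_dep => m.
by congr (_ + _); case: (chP K n) => _ /(_ b bc bs) ->; rewrite bD.
Qed.

End ChExact.

Section ChQ.
Variables (K : fieldType) (a : peak_composition) (r : rel (box a)).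
Implicit Types (S : {set SPIT a}) (T U : SPIT a).
Let M := Q_module K r.

Lemma ex_supported S : exists W : {vspace Q_space K a},
  forall v, (v \in W) = [forall T, (T \notin S) ==> (v T == 0)].
Proof.
have [|g gE] := @ex_lfun K (Q_space K a) (Q_space K a)
    (fun v => [ffun T => if T \in S then 0 else v T]).
  move=> k u v; apply/ffunP=> T; rewrite !ffunE.
  by case: ifP => // _; rewrite scaler0 addr0.
exists (lker g) => v; rewrite memv_ker gE.
apply/eqP/forallP=> [/ffunP H T|H].
  by apply/implyP=> /negPf nT; have := H T; rewrite !ffunE nT => ->.
apply/ffunP=> T; rewrite !ffunE; case: ifP => // /negbT nT.
by apply/eqP; apply: implyP (H T) nT.
Qed.

Definition supported S : {vspace M} := sval (cid (ex_supported S)).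

Lemma supportedP S (v : Q_space K a) :
  reflect (forall T, T \notin S -> v T = 0) (v \in supported S).
Proof.
rewrite (svalP (cid (ex_supported S))).
by apply: (iffP forallP) => H T;
  [move/(implyP (H T))/eqP | apply/implyP => /H ->].
Qed.

Definition up_closed S : Prop := forall T U i, T \in S ->
  val U = sact i (val T) -> i \notin Des (reading r (val T)) -> U \in S.

Lemma Q_pi_val i (v : Q_space K a) T : Q_pi K r i v T =
  if i \in Des (reading r (val T)) then coef v (sact i (val T)) - v T else 0.
Proof.
have hT : is_SPIT (val T) := asboolW (valP T).
by rewrite -coef_val (coef_Q_pi _ _ _ hT) coef_val.
Qed.

Lemma coef_supported S i T (v : Q_space K a) : up_closed S ->
  v \in supported S ->
  T \notin S -> i \in Des (reading r (val T)) -> coef v (sact i (val T)) = 0.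
Proof.
move=> up /supportedP vS nT dT; rewrite /coef; case: insubP => // U _ UE.
apply: vS; apply: contra nT => US; apply: (up _ _ i US).
  by rewrite UE sactK.
rewrite UE Des_sact ?dT //; apply: SPIT_inj; exact: asboolW (valP T).
Qed.

Lemma supported_stable S : up_closed S -> stable (supported S).
Proof.
move=> up i v vS; apply/supportedP=> T nT; rewrite /= Q_pi_val.
case: ifP => // dT; rewrite (coef_supported up vS nT dT) sub0r.
by move/supportedP: vS => /(_ T nT) ->; rewrite oppr0.
Qed.

(* Removing a tableau with fewest inversions keeps S closed under the arrows. *)
Lemma ch_supported S (H : stable (supported S)) : up_closed S ->
  ch (submodule H) =
  fun m => \sum_(T in S) fundamental K (Des (reading r (val T))) m.
Proof.
have [k] := ubnP #|S|; elim: k S H => // k IH S H Sk up.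
have [S0|[T0 T0S]] := set_0Vmem S.
  rewrite (ch_zero (M := submodule H)) => [|v].
    by apply: functional_extensionality_dep => m; rewrite S0 big_set0.
  apply: subvs_inj; rewrite linear0; apply/ffunP=> T; rewrite [RHS]ffunE.
  by have /supportedP := subvsP v; apply; rewrite S0 inE.
pose len T := #|pinv (reading r (val T))|.
case: (arg_minnP len T0S) => T TS Tmin; have {}TS : T \in S by [].
have hT (U : SPIT a) : is_SPIT (val U) := asboolW (valP U).
have upT : up_closed (S :\ T).
  move=> U V i; rewrite !in_setD1 => /andP[UT US] VE ni.
  rewrite (up _ _ _ US VE ni) andbT; apply/eqP=> VT.
  have := proper_card (pinv_cover ni); rewrite -reading_sact;
    last exact: SPIT_inj.
  by rewrite -VE VT ltnNge Tmin.
have HT := supported_stable upT.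
have [g gE] : exists g : 'Hom(M, K^o), forall v, g v = (v : Q_space K a) T.
  by apply: ex_lfun => c u v; rewrite !ffunE.
have := @ch_step K _ M _ _ HT H (Des (reading r (val T))) g (basis K T).
move=> ->.
- rewrite IH //; first by apply: functional_extensionality_dep => m;
    rewrite [RHS](big_setD1 T) //= addrC.
  by rewrite -ltnS; apply: leq_trans Sk;
    rewrite ltnS [X in (_ < X)%N](cardsD1 T) TS.
- apply/subvP=> v /supportedP vS; apply/supportedP=> U nU; apply: vS.
  by rewrite !inE negb_and nU orbT.
- move=> v /supportedP vS; rewrite gE; apply/supportedP/eqP => [->|vT U] //.
    by rewrite !inE eqxx.
  by rewrite !inE negb_and negbK => /orP[/eqP->|/vS].
- by apply/supportedP=> U nU; rewrite ffunE; case: eqP => // E;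
    rewrite E TS in nU.
- by rewrite gE ffunE eqxx.
move=> v vS i; rewrite !gE /= Q_pi_val; case: ifP => dT;
  last by rewrite scale0r.
rewrite scaleN1r /coef; case: insubP => [U _ UE|_]; last by rewrite sub0r.
(* [U] is below [T], with fewer inversions, so it is outside [S] by the choice of [T]. *)
suff -> : v U = 0 by rewrite sub0r.
move/supportedP: vS; apply; apply/negP=> US; have := Tmin _ US.
have ni : i \notin Des (reading r (val U)).
  by rewrite UE Des_sact ?dT //; apply: SPIT_inj.
have := proper_card (pinv_cover ni); rewrite -reading_sact;
  last exact: SPIT_inj.
by rewrite UE sactK /len UE; lia.
Qed.

Lemma ch_Q : ch M = fun m =>
  \sum_(T : SPIT a) fundamental K (Des (reading r (val T))) m.
Proof.
have up : up_closed setT by move=> *; rewrite inE.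
have E : supported setT = fullv.
  by apply/vspaceP=> v; rewrite memvf; apply/supportedP=> T; rewrite inE.
have H := supported_stable up; have := ch_supported H up.
move: H; rewrite E => H; rewrite -ch_full => ->.
by apply: functional_extensionality_dep => m; apply: eq_bigl => T; rewrite inE.
Qed.

End ChQ.

Lemma ch_Q_compatible (K : fieldType) (a : peak_composition)
    (p q : rel (box a)) :
  compatible p -> compatible q -> ch (Q_module K p) = ch (Q_module K q).
Proof.
move=> hp hq; rewrite !ch_Q; apply: functional_extensionality_dep => m.
have E r : \sum_(T : SPIT a) fundamental K (Des (reading r (val T))) m =
    \sum_(D : {set 'I_(sumn a).-1}) fundamental K D m *+
      #|[set T : SPIT a | Des (reading r (val T)) == D]|.
  rewrite (partition_big
    (fun T : SPIT a => Des (reading r (val T))) xpredT) //=.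
  apply: eq_bigr => D _; rewrite -sumr_const; apply: eq_big => T.
    by rewrite inE.
  by move/eqP->.
by rewrite !E; apply: eq_bigr => D _; rewrite (card_Des_eq D hp hq).
Qed.

End Characteristic.

Theorem theorem3p19 (R : realType) (a : peak_composition) :
  [/\ ch (Q_c R[i] a) = ch (Q_r R[i] a),
      (count (ltn 2) a <= 1 -> Q_c R[i] a = Q_r R[i] a) /\
      (~ (count (ltn 2) a <= 1) -> ~ hecke_iso (Q_c R[i] a) (Q_r R[i] a))
    & count (ltn 2) a <= 1 ->
      dp_isomorphic (RW_c a) (RW_r a) /\
      let xi := perm_comp (w_c (Tsource a)) (w_c (Tsup a))^-1%g in
      forall g g', g \in int_R (w_c (Tsup a)) (w_r (Tsup a)) ->
                   g' \in int_R (w_c (Tsup a)) (w_r (Tsup a)) ->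
        dp_isomorphic (int_L g (perm_comp xi g)) (int_L g' (perm_comp xi g'))].
Proof.
split.
- exact: ch_Q_compatible (@compatible_col a) (@compatible_row a).
- split=> [one_arm|many_arms].
    by apply: eq_Q_module => T hT; apply: Des_agree.
  have /card_gt1_count[r1 [r2 [r12 r2a arm1 arm2]]] : 1 < count (ltn 2) a.
    by rewrite ltnNge; apply/negP.
  exact: Q_not_iso r12 r2a arm1 arm2.
move=> one_arm; split; first exact: RW_dp_isomorphic.
by move=> xi g g'; apply: interval_dp_isomorphic.
Qed.
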